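(* Let $k\ge1$, let $\alpha_1,\beta_1,\beta_2\in\mathbb{R}$ with $\alpha_1^2+\beta_1\beta_2\ne\frac14$, assume a uniform mesh of size $h$, and suppose $|\Gamma|>|\Lambda|$ (Case 1). Then for $p=2,\infty$ and periodic $u\in W^{k+1,\infty}(I)$: if $\Gamma<0$, $$\|P_h^\star u-u\|_{L^p(I)}\le Ch^{k+1}|u|_{W^{k+1,\infty}(I)}\Bigg(1+\frac{|\lambda_2|+1}{|\lambda_2|-1}\Big(\|Q_1V_1\|_\infty+h^{-1}\|Q_1V_2\|_\infty\Big)+\frac{1}{|\lambda_2|-1}\Big(\|V_1\|_\infty+h^{-1}\|V_2\|_\infty\Big)\Bigg),$$ and if $\Gamma>0$, $$\|P_h^\star u-u\|_{L^p(I)}\le Ch^{k+1}|u|_{W^{k+1,\infty}(I)}\Bigg(1+\frac{|\lambda_1|+1}{|\lambda_1|-1}\Big(\|(I_2-Q_1)V_1\|_\infty+h^{-1}\|(I_2-Q_1)V_2\|_\infty\Big)+\frac{1}{|\lambda_1|-1}\Big(\|V_1\|_\infty+h^{-1}\|V_2\|_\infty\Big)\Bigg).$$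
   Context: Mesh: $I=[a,b]$, $a=x_{1/2}<\dots<x_{N+1/2}=b$, $I_j=(x_{j-1/2},x_{j+1/2})$, uniform with $h=(b-a)/N$. $V_h^k$ is the space of functions on $I$ whose restriction to each $I_j$ is a polynomial of degree at most $k$. At an interface, $v^\pm$ denote the limits from the right ($+$) and left ($-$) cells, with periodic identification of $x_{1/2}$ and $x_{N+1/2}$; $[v]=v^+-v^-$, $\{v\}=\frac12(v^++v^-)$; the same notation is used for the piecewise derivative $v_x$. Projection $P_h^\star$ (depending on $\alpha_1,\beta_1,\beta_2$): for a periodic function $u$, $P_h^\star u$ is the unique $w\in V_h^k$ satisfying, for all $j=1,\dots,N$, (i) $\int_{I_j}w\,v_h\,dx=\int_{I_j}u\,v_h\,dx$ for all $v_h\in P^{k-2}(I_j)$ (void if $k=1$); (ii) $\{w\}-\alpha_1[w]+\beta_2[w_x]=u$ at $x_{j+1/2}$; (iii) $\{w_x\}+\alpha_1[w_x]+\beta_1[w]=u_x$ at $x_{j+1/2}$. When $|\Gamma|>|\Lambda|$ it exists and is unique. Quantities: $\Gamma=\beta_1+\frac{k^2(k^2-1)}{h^2}\beta_2-\frac{2k^2}{h}(\alpha_1^2+\beta_1\beta_2+\frac14)$, $\Lambda=-\frac{2k}{h}(\alpha_1^2+\beta_1\beta_2-\frac14)$, $c_2=\frac{2k\alpha_1}{h}$, $b_1=-\beta_1-\frac{k^2(k^2+1)}{h^2}\beta_2+\frac{2k^2}{h}(\alpha_1^2+\beta_1\beta_2+\frac14)$, $b_2=-\frac{2k^3}{h^2}\beta_2+\frac{2k}{h}(\alpha_1^2+\beta_1\beta_2+\frac14)$,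 $\lambda_1=\frac{(-1)^{k+1}}{\Lambda}(\Gamma+\sqrt{\Gamma^2-\Lambda^2})$, $\lambda_2=\frac{(-1)^{k+1}}{\Lambda}(\Gamma-\sqrt{\Gamma^2-\Lambda^2})$, $$V_1=\frac1\Lambda\begin{bmatrix}-\beta_1+\frac{k(k+1)}{h}\big((\frac12-\alpha_1)^2+\beta_1\beta_2\big)\\ \beta_1-\frac{k(k-1)}{h}\big((\frac12-\alpha_1)^2+\beta_1\beta_2\big)\end{bmatrix},\qquad V_2=\begin{bmatrix}-\frac{h}{2k}\\ \frac{h}{2k}\end{bmatrix}.$$ The matrix $Q_1$ is $$Q_1=\frac{1}{2\sqrt{\Gamma^2-\Lambda^2}}\begin{bmatrix}c_2+\sqrt{\Gamma^2-\Lambda^2}&b_1+b_2\\ b_1-b_2&-c_2+\sqrt{\Gamma^2-\Lambda^2}\end{bmatrix},$$ except when $(b_1-b_2)(b_1+b_2)=0$ and $c_2<0$, in which case $$Q_1=\frac{1}{2c_2}\begin{bmatrix}2c_2&b_1+b_2\\ b_1-b_2&0\end{bmatrix}.$$ $I_2$ is the $2\times2$ identity matrix and $\|\cdot\|_\infty$ is the max norm of vectors. ''Periodic $u\in W^{m,\infty}(I)$'' means that the $(b-a)$-periodic extension of $u$ has this regularity; $|u|_{W^{m,\infty}(I)}$ is the Sobolev seminorm. $C$ is a generic constant independent of $h$, of $\alpha_1,\beta_1,\beta_2$ (which may depend on $h$), and of $u$. *)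

(* Defs.v *)
From HB Require Import structures.
From mathcomp Require Import all_boot all_order all_algebra.
From mathcomp Require Import all_classical all_reals all_analysis.

Set Implicit Arguments.
Unset Strict Implicit.
Unset Printing Implicit Defensive.

Import Order.TTheory GRing.Theory Num.Theory.
Import numFieldNormedType.Exports.

Local Open Scope classical_set_scope.
Local Open Scope ring_scope.

Section sobolev.
Context {R : realType}.
Local Notation mu := (@lebesgue_measure R).

(* C_c^m functions on the line *)
Definition test_function (m : nat) (phi : R -> R) : Prop :=
  [/\ forall i (x : R), (i < m)%N -> derivable (derive1n i phi) x 1,
      forall i, (i <= m)%N -> continuous (derive1n i phi)
    & exists M : R, forall x, M < `|x| -> phi x = 0].

(* As in Gilbarg and Trudinger, weak derivatives of order m are tested against
   compactly supported functions of class C^m; smooth test functions would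
   give the same notion. *)
Definition is_weak_derivative (m : nat) (u g : R -> R) : Prop :=
  [/\ locally_integrable [set: R] u, locally_integrable [set: R] g
    & forall phi, test_function m phi ->
        \int[mu]_x (u x * derive1n m phi x) = (-1) ^+ m * \int[mu]_x (g x * phi x)].

(* a representative of the m-th weak derivative, unique up to a null set;
   meaningful only when such a derivative exists *)
Definition weak_derivative (m : nat) (u : R -> R) : R -> R :=
  get [set g | is_weak_derivative m u g].

(* u is the continuous representative of a (b-a)-periodic function of class
   W^{m,oo}; periodicity makes u its own periodic extension. *)
Definition periodic_sobolev_oo (m : nat) (a b : R) (u : R -> R) : Prop :=
  [/\ forall x, u (x + (b - a)) = u x,
      continuous u
    & forall i, (i <= m)%N -> exists2 g : R -> R,
        is_weak_derivative i u g & ('N[mu]_+oo[EFin \o g] < +oo)%E].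

(* the norm of L^p([a, b]) *)
Definition Lp_norm (a b : R) (p : \bar R) (f : R -> R) : \bar R :=
  ('N[mu]_p[(EFin \o f) \_ `[a, b]])%E.

Definition sobolev_oo_seminorm (m : nat) (a b : R) (u : R -> R) : \bar R :=
  Lp_norm a b +oo%E (weak_derivative m u).

End sobolev.

(* Cells are numbered from 0, so that cell j is ](node j), (node j.+1)[ and the
   interface x_{j+1/2} of the mathematics, j = 1, ..., N, is node j. *)
Section discretization.
Context {R : realType}.
Variables (a b : R) (N : nat).
Local Notation mu := (@lebesgue_measure R).

Definition mesh_size : R := (b - a) / N%:R.

Definition node (j : nat) : R := a + j%:R * mesh_size.

Definition cell (j : nat) : set R := `]node j, node j.+1[.

(* The values of v at the nodes are irrelevant, as for any function that is
   only specified cell by cell. *)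
Definition dg_space (k : nat) (v : R -> R) : Prop :=
  forall j, (j < N)%N -> exists2 q : {poly R},
    (size q <= k.+1)%N & forall x, cell j x -> v x = q.[x].

Definition trace_minus (v : R -> R) (j : nat) : R :=
  lim (v x @[x --> (node j)^'-]).

(* j %% N maps the last interface N to the first one, 0, and fixes the others *)
Definition trace_plus (v : R -> R) (j : nat) : R :=
  lim (v x @[x --> (node (j %% N))^'+]).

Definition jump (v : R -> R) (j : nat) : R := trace_plus v j - trace_minus v j.

Definition average (v : R -> R) (j : nat) : R :=
  2^-1 * (trace_plus v j + trace_minus v j).

Definition is_Phstar (k : nat) (alpha1 beta1 beta2 : R) (u w : R -> R) : Prop :=
  [/\ dg_space k w,
      forall j, (j < N)%N -> forall v : {poly R}, (size v <= k.-1)%N ->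
        \int[mu]_(x in cell j) (w x * v.[x]) =
        \int[mu]_(x in cell j) (u x * v.[x]),
      forall j, (1 <= j <= N)%N ->
        average w j - alpha1 * jump w j + beta2 * jump (derive1 w) j = u (node j)
    & forall j, (1 <= j <= N)%N ->
        average (derive1 w) j + alpha1 * jump (derive1 w) j + beta1 * jump w j =
        derive1 u (node j)].

End discretization.

Section quantities.
Context {R : realType}.
Variables (k : nat) (h alpha1 beta1 beta2 : R).
Local Notation K := (k%:R : R).

Definition mx22 (x y z t : R) : 'M[R]_2 :=
  \matrix_(i, j) if i == 0 then (if j == 0 then x else y)
                 else (if j == 0 then z else t).

Definition cv2 (x y : R) : 'cV[R]_2 := \col_i if i == 0 then x else y.

Definition Gam : R :=
  beta1 + K ^+ 2 * (K ^+ 2 - 1) / h ^+ 2 * beta2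
  - 2 * K ^+ 2 / h * (alpha1 ^+ 2 + beta1 * beta2 + 4^-1).

Definition Lam : R :=
  - (2 * K / h) * (alpha1 ^+ 2 + beta1 * beta2 - 4^-1).

Definition c2 : R := 2 * K * alpha1 / h.

Definition b1 : R :=
  - beta1 - K ^+ 2 * (K ^+ 2 + 1) / h ^+ 2 * beta2
  + 2 * K ^+ 2 / h * (alpha1 ^+ 2 + beta1 * beta2 + 4^-1).

Definition b2 : R :=
  - (2 * K ^+ 3 / h ^+ 2) * beta2
  + 2 * K / h * (alpha1 ^+ 2 + beta1 * beta2 + 4^-1).

Definition disc : R := Num.sqrt (Gam ^+ 2 - Lam ^+ 2).

Definition lambda1 : R := (-1) ^+ k.+1 / Lam * (Gam + disc).

Definition lambda2 : R := (-1) ^+ k.+1 / Lam * (Gam - disc).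

Definition V1 : 'cV[R]_2 := Lam^-1 *:
  cv2 (- beta1 + K * (K + 1) / h * ((2^-1 - alpha1) ^+ 2 + beta1 * beta2))
      (beta1 - K * (K - 1) / h * ((2^-1 - alpha1) ^+ 2 + beta1 * beta2)).

Definition V2 : 'cV[R]_2 := cv2 (- (h / (2 * K))) (h / (2 * K)).

Definition Q1 : 'M[R]_2 :=
  if ((b1 - b2) * (b1 + b2) == 0) && (c2 < 0) then
    (2 * c2)^-1 *: mx22 (2 * c2) (b1 + b2) (b1 - b2) 0
  else
    (2 * disc)^-1 *: mx22 (c2 + disc) (b1 + b2) (b1 - b2) (- c2 + disc).

(* The norm of 'cV[R]_2 below is mx_norm, the maximum of the absolute values of
   the entries. *)
Definition factor_neg : R :=
  1 + (`|lambda2| + 1) / (`|lambda2| - 1)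
      * (`|Q1 *m V1| + h^-1 * `|Q1 *m V2|)
    + (`|lambda2| - 1)^-1 * (`|V1| + h^-1 * `|V2|).

Definition factor_pos : R :=
  1 + (`|lambda1| + 1) / (`|lambda1| - 1)
      * (`|(1%:M - Q1) *m V1| + h^-1 * `|(1%:M - Q1) *m V2|)
    + (`|lambda1| - 1)^-1 * (`|V1| + h^-1 * `|V2|).

End quantities.

(* Main.v *)
Require Import Defs.
From mathcomp Require Import all_boot all_order all_algebra.
From mathcomp Require Import all_classical all_reals all_analysis.
From mathcomp Require Import measurable_realfun ess_sup_inf ring lra.

Import Order.TTheory GRing.Theory Num.Theory.
Import numFieldNormedType.Exports.

Local Open Scope classical_set_scope.
Local Open Scope ring_scope.

(* On each cell, u is compared with the polynomial of degree k that has the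
   moments of u up to order k - 2, the value of u at the right end and the
   derivative of u at the left end; the error is O(h^(k+1)). What remains of w on
   cell j is orthogonal to P^(k-2), hence of the form y1 P_(k-1) + y2 P_k with
   Legendre polynomials, and the interface conditions turn into a periodic
   recursion y_j = P y_(j+1) + f_j V1 + g_j V2 with f_j = O(h^(k+1)) and
   g_j = O(h^k). The eigenvalues of P are lambda1 and lambda2, of product 1. The
   component of y on the small eigenvalue is bounded because the recursion is a
   contraction, the other one because the reversed recursion is; adding the two
   bounds gives the stated factor, with the spectral projection of P for Q1. In
   the exceptional case Q1 is the complementary projection. This does no harm:
   V1 = P v0 with v0 bounded, so that the component of V1 on the large eigenvalue
   controls the other one up to a constant.

   The Taylor polynomials of u come from the representation of u as a polynomial
   plus an iterated primitive of its weak derivative (Fubini and the lemma of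
   du Bois-Reymond). *)

(** * Weak derivatives *)

Section primitive.
Context {R : realType}.
Local Notation mu := (@lebesgue_measure R).
Implicit Types (c d x y : R) (f g phi psi : R -> R).

Definition locally_integrable_from c f : Prop :=
  forall y, mu.-integrable `[c, y] (EFin \o f).

(** For [x < c] the interval is empty and the value is 0, not minus an integral; for general [f] the
    derivative is [f] only to the right of [c]. *)
Definition primitive c f x : R := \int[mu]_(t in `[c, x]) f t.

Lemma locally_integrable_fromT c f :
  locally_integrable [set: R] f -> locally_integrable_from c f.
Proof.
move=> [mf _ If] y; apply/integrableP; split.
  by apply/measurable_EFinP; exact: measurable_funS mf.
by apply: If => //; exact: segment_compact.
Qed.

Lemma continuous_integrable_itv x y f :
  continuous f -> mu.-integrable `[x, y] (EFin \o f).
Proof.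
move=> cf; apply: continuous_compact_integrable; first exact: segment_compact.
exact: continuous_subspaceT.
Qed.

Lemma primitive_left c f x : x <= c -> primitive c f x = 0.
Proof.
rewrite le_eqVlt => /predU1P[->|xc].
  by rewrite /primitive set_itv1 Rintegral_set1.
by rewrite /primitive set_itv_ge ?Rintegral_set0// -leNgt bnd_simp.
Qed.

Lemma continuous_primitive c f :
  locally_integrable_from c f -> continuous (primitive c f).
Proof.
move=> If x; have [xc|cx|->] := ltgtP x c.
- rewrite /continuous_at primitive_left ?(ltW xc)//.
  apply: cvg_near_cst; near=> y; rewrite primitive_left//; apply/ltW.
  by near: y; exact: lt_nbhsl.
- have cx1 : c < x + 1 by rewrite (lt_trans cx)// ltrDl.
  have := parameterized_integral_continuous (ltW cx1) (If (x + 1)).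
  move=> /(continuous_within_itvP _ cx1)[+ _ _]; apply.
  by rewrite in_itv/= cx ltrDl ltr01.
- rewrite /continuous_at primitive_left//.
  by apply: (@parameterized_integral_cvg_left _ c (c + 1)) => //; rewrite ltrDl.
Unshelve. all: by end_near. Qed.

Lemma is_derive_primitive c f x : locally_integrable_from c f -> c < x ->
  {for x, continuous f} -> is_derive x 1 (primitive c f) (f x).
Proof.
move=> If cx fx.
have xx1 : x < x + 1 by rewrite ltrDl.
have [df <-] := continuous_FTC1_closed xx1 (If _) cx fx.
by rewrite derive1E; exact: DeriveDef.
Qed.

Lemma Rintegral_is_derive phi psi c d : c <= d ->
  (forall x, is_derive x 1 phi (psi x)) -> continuous psi ->
  \int[mu]_(x in `[c, d]) psi x = phi d - phi c.
Proof.
rewrite le_eqVlt => /predU1P[->|cd] dphi cpsi.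
  by rewrite set_itv1 Rintegral_set1 subrr.
have cphi : continuous phi.
  by move=> x; apply: differentiable_continuous; apply/derivable1_diffP;
     exact: ex_derive.
rewrite /Rintegral (@continuous_FTC2 R psi phi c d)//.
- exact: continuous_subspaceT.
- split=> [x _||].
  + exact: ex_derive.
  + by apply: cvg_at_right_filter; exact: cphi.
  + by apply: cvg_at_left_filter; exact: cphi.
- by move=> x _; rewrite derive1E derive_val.
Qed.

End primitive.
Section primitive_by_parts.
Context {R : realType}.
Local Notation mu := (@lebesgue_measure R).
Implicit Types (c d x y : R) (f g phi psi : R -> R).

Lemma integrable_mul_continuous c y f phi : locally_integrable_from c f ->
  continuous phi -> mu.-integrable `[c, y] (EFin \o (fun t => f t * phi t)).
Proof.
move=> If cphi; have cphiD := continuous_subspaceT cphi.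
have mD : measurable (`[c, y]%classic : set (measurableTypeR R)).
  exact: measurable_itv.
apply: (integrableMl mD (If y) (h := phi)).
  by apply: subspace_continuous_measurable_fun => //; exact: cphiD.
have /compact_bounded[M [Mr Mb]] := continuous_compact (cphiD _) (@segment_compact _ c y).
by exists M; split => // r Mr' t tD; apply: (Mb _ Mr'); exists t.
Qed.

(* Fubini on the triangle c <= t <= x <= d, since f need not be continuous. *)
Lemma primitive_by_parts c d f phi psi : c <= d ->
  locally_integrable_from c f ->
  (forall x, is_derive x 1 phi (psi x)) -> continuous psi -> phi d = 0 ->
  \int[mu]_(x in `[c, d]) (primitive c f x * psi x) =
  - \int[mu]_(t in `[c, d]) (f t * phi t).
Proof.
move=> cd If dphi cpsi phid.
pose D : set R := `[c, d]%classic.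
have mD : measurable (D : set (measurableTypeR R)) by exact: measurable_itv.
pose fD := f \_ D; pose psiD := psi \_ D.
have ifD : mu.-integrable setT (EFin \o fD).
  by rewrite -restrict_EFin; apply/integrable_restrict => //; rewrite setTI; exact: If.
have ipsiD : mu.-integrable setT (EFin \o psiD).
  rewrite -restrict_EFin; apply/integrable_restrict => //; rewrite setTI.
  exact: continuous_integrable_itv.
have mfD : measurable_fun setT fD by apply/measurable_EFinP; exact: measurable_int ifD.
have mpsiD : measurable_fun setT psiD by apply/measurable_EFinP; exact: measurable_int ipsiD.
(* The integrand on the triangle t <= x, for z = (x, t), extended by 0 to the whole plane. *)
pose F (z : R * R) : \bar R := (if z.2 <= z.1 then fD z.2 * psiD z.1 else 0)%:E.
have mF : measurable_fun setT F.
  apply/measurable_EFinP; apply: measurable_fun_ifT => //.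
    exact: measurable_realfun.measurable_fun_ler.
  apply: measurable_funM.
    exact: (measurableT_comp mfD).
  exact: (measurableT_comp mpsiD).
(* Tonelli: for fixed t the integral of |F| in x is at most |fD t| K, where K is the integral of
   |psiD|. *)
have iF : (mu \x mu)%E.-integrable setT F.
  apply/(integrable21ltyP mu mu mF).
  have iK : (\int[mu]_x `|(psiD x)%:E| < +oo)%E by case/integrableP : ipsiD.
  pose K := fine (\int[mu]_x `|(psiD x)%:E|)%E.
  have KE : (\int[mu]_x `|(psiD x)%:E|)%E = K%:E.
    by rewrite fineK// ge0_fin_numE// integral_ge0.
  have mG : measurable_fun setT (fubini_G mu (abse \o F)).
    apply: measurable_fun_fubini_tonelli_G => //.
      exact: measurableT_comp.
    by move=> z; exact: abse_ge0.
  apply: (@le_lt_trans _ _ (\int[mu]_t (`|fD t|%:E * K%:E))%E).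
    apply: ge0_le_integral => //.
    - by move=> t _; exact: integral_ge0.
    - apply: emeasurable_funM => //; apply/measurable_EFinP.
      exact: measurableT_comp.
    - move=> t _; rewrite -KE -ge0_integralZl//; last first.
        by apply: measurableT_comp => //; exact/measurable_EFinP.
      apply: ge0_le_integral => //.
      + apply: measurableT_comp => //.
        by apply: (measurableT_comp mF); exact: pair2_measurable.
      + apply: emeasurable_funM => //; apply: measurableT_comp => //.
        exact/measurable_EFinP.
      + move=> x _; rewrite /F /= lee_fin -normrM.
        by case: (t <= x)%R; rewrite // normr0.
  have K0 : (0 <= K%:E)%E by rewrite lee_fin fine_ge0// integral_ge0.
  rewrite ge0_integralZr//.
  rewrite lte_mul_pinfty ?integral_ge0 ?ltry//.
    by rewrite ge0_fin_numE ?integral_ge0//; case/integrableP : ifD.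
  by apply/measurable_EFinP; exact: measurableT_comp.
have inner_t x : (\int[mu]_t F (x, t) = (psiD x * primitive c f x)%:E)%E.
  rewrite /psiD patchE; case: ifPn => [|xD]; last first.
    rewrite mul0r integral0_eq// => t _.
    by rewrite /F /= /psiD patchE (negbTE xD) mulr0; case: ifP.
  rewrite inE /D/= in_itv/= => /andP[cx xd].
  transitivity (\int[mu]_(t in `[c, x]) (psi x * f t)%:E)%E.
    rewrite [RHS]integral_mkcond; apply: eq_integral => t _.
    have -> : F (x, t) = (if t <= x then fD t * psi x else 0)%:E.
      by rewrite /F /= /psiD patchE mem_set// /D/= in_itv/= cx.
    rewrite /fD !patchE.
    rewrite !mem_setE !in_itv/=; have [tx|tx] := leP t x.
      by rewrite (le_trans tx xd) andbT; case: ifP; rewrite ?mul0r// mulrC.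
    by rewrite andbF.
  rewrite /primitive -RintegralZl//; first last.
  rewrite /Rintegral fineK//; apply: integrable_fin_num => //.
  exact: (integrableZl _ (psi x) (If x)).
(* The integral of [psi] over [t, d] is phi d - phi t; this is where phi d = 0 enters. *)
have inner_x t : (\int[mu]_x F (x, t) = (fD t * - phi t)%:E)%E.
  rewrite /fD patchE; case: ifPn => [|tD]; last first.
    rewrite mul0r integral0_eq// => x _.
    by rewrite /F /= /fD patchE (negbTE tD) mul0r; case: ifP.
  rewrite inE /D/= in_itv/= => /andP[ct td].
  have <- : \int[mu]_(x in `[t, d]) psi x = - phi t.
    by rewrite (Rintegral_is_derive phi psi t d td dphi)// phid sub0r.
  transitivity (\int[mu]_(x in `[t, d]) (f t * psi x)%:E)%E.
    rewrite [RHS]integral_mkcond; apply: eq_integral => x _.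
    have -> : F (x, t) = (if t <= x then f t * psiD x else 0)%:E.
      by rewrite /F /= /fD patchE mem_set// /D/= in_itv/= ct.
    rewrite /psiD !patchE.
    rewrite !mem_setE !in_itv/=; have [tx|//] := leP t x.
    by rewrite (le_trans ct tx) /=; case: ifP; rewrite ?mulr0.
  rewrite -RintegralZl//; last exact: continuous_integrable_itv.
  rewrite /Rintegral fineK//; apply: integrable_fin_num => //.
  exact: (integrableZl _ (f t) (continuous_integrable_itv t d psi cpsi)).
have /= := Fubini iF.
under eq_integral do rewrite inner_t.
under [X in _ = X -> _]eq_integral do rewrite inner_x.
move=> /(congr1 fine); rewrite -[fine _]/(\int[mu]_x _) -[X in _ = X]/(\int[mu]_x _) => FE.
rewrite Rintegral_mkcond [X in - X]Rintegral_mkcond.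
transitivity (\int[mu]_x (psiD x * primitive c f x)).
  apply: eq_Rintegral => x _; rewrite /psiD !patchE.
  by case: ifP; rewrite ?mul0r// mulrC.
rewrite FE -mulN1r -RintegralZl//; last first.
  have := integrable_mul_continuous c d f phi If.
  rewrite -restrict_EFin => ifphi; apply/integrable_restrict => //; rewrite setTI.
  apply: ifphi => x; apply: differentiable_continuous; apply/derivable1_diffP.
  exact: ex_derive.
apply: eq_Rintegral => x _; rewrite /fD !patchE.
by case: ifP; rewrite ?mul0r ?mulr0// mulrN mulN1r.
Qed.
End primitive_by_parts.

(** * Test functions supported in a fixed interval and the lemma of du Bois-Reymond *)

Section du_bois_reymond.
Context {R : realType}.
Local Notation mu := (@lebesgue_measure R).
Variables (c d : R).
Implicit Types (x y : R) (u v f g phi psi eta theta : R -> R).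

(** The support is fixed, and the derivatives are required to vanish off ]c, d[, so that boundary
    terms disappear in integrations by parts. *)
Definition test_function_on n phi : Prop :=
  [/\ forall i x, (i < n)%N -> derivable (derive1n i phi) x 1,
      forall i, (i <= n)%N -> continuous (derive1n i phi)
    & forall i x, (i <= n)%N -> (x <= c) || (d <= x) -> derive1n i phi x = 0].

Lemma test_function_on_test n phi : test_function_on n phi -> test_function n phi.
Proof.
case=> dphi cphi phi0; split => //; exists (`|c| + `|d|) => x.
rewrite ltNge => xM; apply: (phi0 0) => //; rewrite -[_ || _]negbK negb_or.
apply: contra xM; rewrite -!ltNge => /andP[cx xd].
have := ler_norm d; have := ler_norm (- c); rewrite normrN => ?.
have := normr_ge0 c; have := normr_ge0 d.
by rewrite ler_norml => *; apply/andP; split; lra.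
Qed.

Lemma is_derive_derive1n n phi i x : test_function_on n phi -> (i < n)%N ->
  is_derive x 1 (derive1n i phi) (derive1n i.+1 phi x).
Proof.
by move=> [dphi _ _] /(dphi _ x) di; rewrite derive1nS derive1E; exact: DeriveDef.
Qed.

Lemma derive1n_lin n phi psi (a : R) i : test_function_on n phi ->
  test_function_on n psi -> (i <= n)%N ->
  derive1n i (fun x => phi x - a * psi x) =
  (fun x => derive1n i phi x - a * derive1n i psi x).
Proof.
move=> tphi tpsi; elim: i => // i IHi lin.
rewrite derive1nS IHi ?(ltnW lin)//; apply/funext => x.
have dphi := is_derive_derive1n n phi i x tphi lin.
have dpsi := is_derive_derive1n n psi i x tpsi lin.
have da : is_derive x 1 (fun x => derive1n i phi x - a * derive1n i psi x)
    (derive1n i.+1 phi x - a * derive1n i.+1 psi x).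
  exact: (is_deriveB dphi (is_deriveZ a dpsi)).
by rewrite derive1E derive_val.
Qed.

Lemma test_function_on_lin n phi psi (a : R) : test_function_on n phi ->
  test_function_on n psi -> test_function_on n (fun x => phi x - a * psi x).
Proof.
move=> tphi tpsi; have [_ cphi phi0] := tphi; have [_ cpsi psi0] := tpsi.
split=> [i x lin|i lin|i x lin xcd].
- rewrite (derive1n_lin n)// ?(ltnW lin)//.
  have dphi := is_derive_derive1n n phi i x tphi lin.
  have dpsi := is_derive_derive1n n psi i x tpsi lin.
  by have [] := is_deriveB dphi (is_deriveZ a dpsi).
- rewrite (derive1n_lin n)// => x; apply: cvgB; first exact: cphi.
  by apply: cvgMr; exact: cpsi.
- by rewrite (derive1n_lin n)// phi0// psi0// mulr0 subr0.
Qed.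

(** Since [psi] vanishes to the left of [c], the lower limit of integration can be moved to the left
    of [x], which settles the points [x <= c]. *)
Lemma is_derive_primitive_test psi x : continuous psi ->
  (forall x, x <= c -> psi x = 0) ->
  is_derive x 1 (primitive c psi) (psi x).
Proof.
move=> cpsi psi0; have [cx|xc] := ltP c x.
  apply: is_derive_primitive => //; last exact: cpsi.
  by move=> y; exact: continuous_integrable_itv.
have -> : primitive c psi = primitive (x - 1) psi.
  apply/funext => y; rewrite /primitive Rintegral_mkcond [RHS]Rintegral_mkcond.
  apply: eq_Rintegral => t _; rewrite !patchE !mem_setE !in_itv/=.
  have [ct|tc] := leP c t; first by rewrite (_ : x - 1 <= t)//; lra.
  by rewrite psi0 ?(ltW tc)//; case: ifP.
apply: is_derive_primitive; [|by rewrite gtrBl|exact: cpsi].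
by move=> y; exact: continuous_integrable_itv.
Qed.

(** The zero mean makes the primitive vanish to the right of [d]; to the left of [c] it vanishes
    anyway. *)
Lemma test_function_on_primitive n psi : c <= d -> test_function_on n psi ->
  primitive c psi d = 0 ->
  test_function_on n.+1 (primitive c psi) /\ derive1n 1 (primitive c psi) = psi.
Proof.
move=> cd [dpsi cpsi psi0] I0.
have cpsi0 : continuous psi by exact: (cpsi 0).
have psi00 x : (x <= c) || (d <= x) -> psi x = 0 by exact: (psi0 0).
have dP x : is_derive x 1 (primitive c psi) (psi x).
  by apply: is_derive_primitive_test => // y yc; apply: psi00; rewrite yc.
have E1 : derive1n 1 (primitive c psi) = psi.
  by apply/funext => x; rewrite derive1n1 derive1E derive_val.
have E i : derive1n i.+1 (primitive c psi) = derive1n i psi.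
  by rewrite [LHS]/derive1n iterSr -[X in iter i _ X]/(derive1n 1 (primitive c psi)) E1.
split=> //; split=> [[|i] x lin|[|i] lin|[|i] x lin].
- exact: ex_derive.
- by rewrite E; exact: dpsi.
- by apply: continuous_primitive => y; exact: continuous_integrable_itv.
- by rewrite E; exact: cpsi.
- case/orP => [xc|dx]; first exact: primitive_left.
  rewrite -[RHS]I0 derive1n0 /primitive Rintegral_mkcond [RHS]Rintegral_mkcond.
  apply: eq_Rintegral => t _; rewrite !patchE !mem_setE !in_itv/=.
  have [td|dt] := leP t d; first by rewrite (le_trans td dx).
  by rewrite psi00 ?(ltW dt) ?orbT// ; case: ifP; case: ifP.
- by rewrite E; exact: psi0.
Qed.

End du_bois_reymond.

Section du_bois_reymond_lemma.
Context {R : realType}.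
Local Notation mu := (@lebesgue_measure R).
Variables (c d : R).
Hypothesis cd : c < d.
Implicit Types (x y : R) (u v f g phi psi eta theta : R -> R).

Lemma continuous_iter_primitive n f :
  continuous f -> continuous (iter n (primitive c) f).
Proof.
move=> cf; elim: n => //= n IHn.
by apply: continuous_primitive => y; exact: continuous_integrable_itv.
Qed.

Lemma locally_integrable_from_iter n f : locally_integrable_from c f ->
  locally_integrable_from c (iter n (primitive c) f).
Proof.
move=> If; elim: n => //= n IHn y.
by apply: continuous_integrable_itv; exact: continuous_primitive.
Qed.

Lemma iter_primitive_by_parts n f phi : locally_integrable_from c f ->
  test_function_on c d n phi ->
  \int[mu]_(x in `[c, d]) (iter n (primitive c) f x * derive1n n phi x) =
  (-1) ^+ n * \int[mu]_(x in `[c, d]) (f x * phi x).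
Proof.
move=> If; elim: n => [|n IHn] tphi; first by rewrite expr0 mul1r.
have [dphi cphi phi0] := tphi.
rewrite exprS -mulrA -IHn; last first.
  by split=> [i x lin|i lin|i x lin]; [exact/dphi/leqW|exact/cphi/leqW|exact/phi0/leqW].
rewrite mulN1r; apply: primitive_by_parts (ltW cd) _ _ _ _.
- exact: locally_integrable_from_iter.
- by move=> x; exact: is_derive_derive1n tphi _.
- exact: cphi.
- by apply: phi0; rewrite ?leqnSn// lexx orbT.
Qed.

Lemma is_derive_horner (p : {poly R}) x : is_derive x 1 (horner p) p^`().[x].
Proof. by rewrite derivE derive1E; apply: DeriveDef => //; exact: derivable_horner. Qed.

Lemma iter_primitive1 n x : c <= x ->
  iter n (primitive c) (cst 1) x = (n`!%:R)^-1 * (x - c) ^+ n.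
Proof.
elim: n x => [|n IHn] x cx; first by rewrite expr0 mulr1 fact0 invr1.
rewrite iterS {1}/primitive.
transitivity (\int[mu]_(t in `[c, x]) ((n`!%:R)^-1 * (t - c) ^+ n)).
  by apply: eq_Rintegral => t; rewrite inE /= in_itv/= => /andP[ct _]; exact: IHn.
pose p : {poly R} := (n.+1`!%:R)^-1 *: ('X - c%:P) ^+ n.+1.
have pE t : p.[t] = (n.+1`!%:R)^-1 * (t - c) ^+ n.+1.
  by rewrite hornerZ horner_exp !hornerE.
have p'E t : p^`().[t] = (n`!%:R)^-1 * (t - c) ^+ n.
  rewrite derivZ hornerZ deriv_exp derivXsubC mul1r hornerMn horner_exp hornerXsubC.
  rewrite factS natrM; field.
  by rewrite nat1r !pnatr_eq0 -lt0n fact_gt0.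
transitivity (p.[x] - p.[c]); last by rewrite !pE subrr expr0n/= mulr0 subr0.
apply: Rintegral_is_derive => //.
- by move=> t; rewrite -p'E; exact: is_derive_horner.
- rewrite (_ : (fun _ => _) = horner p^`()); first exact: continuous_horner.
  by apply/funext => t; rewrite p'E.
Qed.

(** The primitive lies between 0 and the total integral, hence vanishes inside, and so does its
    derivative [f]. *)
Lemma Rintegral_continuous_ge0_eq0 f : continuous f ->
  (forall x, 0 <= f x) -> \int[mu]_(x in `[c, d]) f x = 0 ->
  forall x, c < x < d -> f x = 0.
Proof.
move=> cf f0 I0 x /andP[cx xd].
have If : locally_integrable_from c f by move=> y; exact: continuous_integrable_itv.
have P0 y : c < y -> y < d -> primitive c f y = 0.
  move=> cy yd; apply/eqP; rewrite eq_le; apply/andP; split; last exact: Rintegral_ge0.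
  rewrite -I0 -subr_ge0 /primitive Rintegral_itvB ?bnd_simp ?(ltW cy) ?(ltW yd)//.
  exact: Rintegral_ge0.
have dP := is_derive_primitive c f x If cx (cf x).
have : 'D_1 (primitive c f) x = 'D_1 (cst 0 : R -> R) x.
  apply: near_eq_derive; rewrite ?oner_neq0//.
  near=> y; rewrite P0//.
    by near: y; exact: lt_nbhsr.
  by near: y; exact: lt_nbhsl.
by rewrite derive_val derive_cst.
Unshelve. all: by end_near. Qed.

(** Induction on n. A test function of order n with zero mean has a primitive that is a test
    function of order n + 1, so that [v] annihilates its n-th derivative. The mean of a general one
    is corrected by a multiple of [theta], which amounts to subtracting from [v] a multiple of (x -
    c)^n. *)
Lemma du_bois_reymond n v : continuous v ->
  (forall phi, test_function_on c d n phi ->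
     \int[mu]_(x in `[c, d]) (v x * derive1n n phi x) = 0) ->
  exists2 p : {poly R}, (size p <= n)%N & forall x, c < x < d -> v x = p.[x].
Proof.
elim: n v => [|n IHn] v cv v0.
  exists 0; first by rewrite size_poly0.
  (* For n = 0 a test function need only be continuous, so [v] times [bump] is admissible, and the
     integral of v^2 times [bump] vanishes. *)
  pose bump x : R := Num.max 0 ((x - c) * (d - x)).
  have cbump : continuous bump.
    rewrite (_ : bump = cst 0 \max horner (('X - c%:P) * (d%:P - 'X))); last first.
      by apply/funext => x; rewrite /bump /= !hornerE.
    by move=> x; apply: continuous_max; [exact: cvg_cst|exact: continuous_horner].
  have bump0 x : 0 <= bump x by rewrite le_max lexx.
  move=> x xcd; rewrite horner0.
  have : v x * (v x * bump x) = 0.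
    apply: (Rintegral_continuous_ge0_eq0 (fun x => v x * (v x * bump x))) => //.
    - by move=> y; apply: cvgM; [exact: cv|apply: cvgM; [exact: cv|exact: cbump]].
    - by move=> y; rewrite mulrA mulr_ge0// -expr2 sqr_ge0.
    - apply: (v0 (fun x => v x * bump x)); split=> //.
      + by case=> // _ y; apply: cvgM; [exact: cv|exact: cbump].
      + case=> // y _ ycd; rewrite /= /bump max_l ?mulr0//.
        by case/orP : ycd => ?; [rewrite mulr_le0_ge0|rewrite mulr_ge0_le0]; lra.
  move/eqP; rewrite mulrA mulf_eq0 -expr2 sqrf_eq0 => /orP[/eqP//|].
  rewrite /bump max_r; last by rewrite mulr_ge0//; lra.
  by rewrite mulf_eq0 => /orP[] /eqP; lra.
(* If some test function has nonzero mean, it is used to correct the mean of the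
   others; if there is none, every test function is already a derivative. This
   avoids the construction of a bump function of class C^n. *)
have [[theta ttheta Itheta]|noth] := pselect (exists2 theta,
    test_function_on c d n theta & \int[mu]_(x in `[c, d]) theta x != 0).
- pose T := \int[mu]_(x in `[c, d]) theta x.
  pose L := \int[mu]_(x in `[c, d]) (v x * derive1n n theta x).
  (* This choice is forced: [v] against the n-th derivative of [eta] gives L / T times the integral
     of [eta], and the n-fold primitive of 1 gives (-1)^n times that integral. *)
  pose k := (-1) ^+ n * (L / T).
  pose v' x := v x - k * iter n (primitive c) (cst 1) x.
  have cI : continuous (iter n (primitive c) (cst 1)).
    by apply: continuous_iter_primitive => x; exact: cvg_cst.
  have cv' : continuous v'.
    by move=> x; apply: cvgB; [exact: cv|apply: cvgMr; exact: cI].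
  have [eta teta|p sp pE] := IHn v' cv'.
    pose r := (\int[mu]_(x in `[c, d]) eta x) / T.
    have tr := test_function_on_lin c d n eta theta r teta ttheta.
    have [_ ceta _] := teta; have [_ ctheta _] := ttheta.
    have cetan : continuous (derive1n n eta) by exact: ceta.
    have cthetan : continuous (derive1n n theta) by exact: ctheta.
    have ceta0 : continuous eta by exact: (ceta 0).
    have ctheta0 : continuous theta by exact: (ctheta 0).
    have I0 : primitive c (fun x => eta x - r * theta x) d = 0.
      rewrite /primitive RintegralB//; first last.
      - by apply: continuous_integrable_itv => x; apply: cvgMr; exact: ctheta0.
      - exact: continuous_integrable_itv.
      - rewrite RintegralZl//; last exact: continuous_integrable_itv.
        by rewrite /r divfK// subrr.
    have [tP P1] := test_function_on_primitive c d n _ (ltW cd) tr I0.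
    have := v0 _ tP.
    rewrite /derive1n iterSr -[derive1 _]/(derive1n 1 _) P1 -/(derive1n n _).
    rewrite (derive1n_lin c d n)//.
    have mulB (w f1 f2 : R -> R) s : continuous w -> continuous f1 -> continuous f2 ->
        \int[mu]_(x in `[c, d]) (w x * (f1 x - s * f2 x)) =
        \int[mu]_(x in `[c, d]) (w x * f1 x) - s * \int[mu]_(x in `[c, d]) (w x * f2 x).
      move=> cw cf1 cf2.
      have i1 : mu.-integrable `[c, d] (EFin \o (fun x => w x * f1 x)).
        by apply: continuous_integrable_itv => x; apply: cvgM; [exact: cw|exact: cf1].
      have c2 : continuous (fun x => w x * f2 x).
        by move=> x; apply: cvgM; [exact: cw|exact: cf2].
      rewrite -RintegralZl//; last exact: continuous_integrable_itv.
      rewrite -RintegralB//; last first.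
        by apply: continuous_integrable_itv => x; apply: cvgMr; exact: c2.
      by apply: eq_Rintegral => x _; rewrite mulrBr mulrCA.
    rewrite mulB// -/L => /eqP; rewrite subr_eq0 => /eqP vE.
    transitivity (\int[mu]_(x in `[c, d])
      (derive1n n eta x * (v x - k * iter n (primitive c) (cst 1) x))).
      by apply: eq_Rintegral => x _; rewrite mulrC.
    rewrite mulB//.
    under eq_Rintegral do rewrite mulrC.
    under [X in _ - k * X]eq_Rintegral do rewrite mulrC.
    rewrite vE iter_primitive_by_parts//; last first.
      by move=> y; apply: continuous_integrable_itv => x; exact: cvg_cst.
    under [X in (-1) ^+ n * X]eq_Rintegral do rewrite mul1r.
    have ss : (-1) ^+ n * (-1) ^+ n = 1 :> R.
      by rewrite -exprD addnn -signr_odd odd_double.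
    rewrite /r /k; set s := (-1) ^+ n in ss *; set I := Rintegral _ _ _.
    have -> : s * (L / T) * (s * I) = (s * s) * (I / T * L) by ring.
    by rewrite ss mul1r subrr.
  exists (p + (k / n`!%:R) *: ('X - c%:P) ^+ n).
    rewrite (leq_trans (size_polyD _ _))// geq_max (leqW sp)/=.
    by rewrite (leq_trans (size_scale_leq _ _))// size_exp_XsubC.
  move=> x /[dup] xcd /pE; rewrite /v' iter_primitive1; last by case/andP: xcd => /ltW.
  rewrite hornerD hornerZ horner_exp !hornerE => /eqP; rewrite subr_eq => /eqP ->.
  by [].
- have [eta teta|p sp pE] := IHn v cv; last by exists p => //; exact: leqW.
  have I0 : primitive c eta d = 0.
    by apply/eqP/negPn/negP => Ieta; apply: noth; exists eta.
  have [tP P1] := test_function_on_primitive c d n _ (ltW cd) teta I0.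
  have := v0 _ tP.
  by rewrite /derive1n iterSr -[derive1 _]/(derive1n 1 _) P1.
Qed.

End du_bois_reymond_lemma.

(** * Representation of a Sobolev function by iterated primitives of its weak derivative *)

Section sobolev_representation.
Context {R : realType}.
Local Notation mu := (@lebesgue_measure R).
Implicit Types (x y : R) (u g phi : R -> R).

Lemma norm_Rintegral_le_ae x y (M : R) g : x <= y ->
  mu.-integrable `]x, y] (EFin \o g) ->
  {ae mu, forall t, t \in `]x, y] -> `|g t| <= M} ->
  `|\int[mu]_(t in `]x, y]) g t| <= M * (y - x).
Proof.
move=> xy ig gM.
(* A negative [M] would make every point of the interval exceptional, although its measure is
   positive. *)
have M0 : x < y -> 0 <= M.
  move=> lxy; rewrite leNgt; apply/negP => M0.
  case: gM => N [mN N0 gN].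
  have : (mu `]x, y] <= mu N)%E.
    apply: le_measure; rewrite ?inE//.
    move=> t xyt; apply: gN => /= /(_ xyt) gtM.
    by have := normr_ge0 (g t); rewrite leNgt (le_lt_trans gtM).
  rewrite N0 lebesgue_measure_itv/= lte_fin lxy -EFinD lee_fin leNgt subr_gt0.
  by rewrite lxy.
move: xy; rewrite le_eqVlt => /predU1P[->|lxy].
  by rewrite set_itv_ge ?Rintegral_set0 ?normr0 ?subrr ?mulr0// -leNgt bnd_simp.
apply: (le_trans (le_normr_Rintegral _ ig)) => //.
rewrite -lee_fin /Rintegral fineK; last first.
  by apply: integrable_fin_num => //; exact: integrable_norm.
apply: (@le_trans _ _ (\int[mu]_(t in `]x, y]) (cst M%:E t))%E).
  apply: ae_ge0_le_integral => //.
  - exact: measurable_int (integrable_norm ig).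
  - by move=> t _; rewrite lee_fin M0.
by rewrite integral_cst//= lebesgue_measure_itv/= lte_fin lxy -EFinD -EFinM.
Qed.

(** By [du_bois_reymond], u minus the (k + 1)-fold primitive of [g] is a polynomial of degree at
    most k on ]c, d[. [U i] is the i-th derivative of this representation. The last one, [U k], is
    an affine image of the primitive of [g], and only its increments are described, since [g] may be
    discontinuous. *)
Lemma weak_derivative_chain k u g (c d : R) : c < d -> continuous u ->
  is_weak_derivative k.+1 u g ->
  exists U : nat -> R -> R,
  [/\ forall x, c < x < d -> U 0 x = u x,
      forall i x, (i < k)%N -> c < x < d -> is_derive x 1 (U i) (U i.+1 x)
    & forall x y, c < x -> x <= y -> y < d ->
        U k y - U k x = \int[mu]_(t in `]x, y]) g t].
Proof.
move=> cd cu [_ Lg wd].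
have Ig := locally_integrable_fromT c g Lg.
pose G i := iter i (primitive c) g.
have cG i : continuous (G i.+1).
  by apply: continuous_primitive; exact: locally_integrable_from_iter.
have iG y i : mu.-integrable `[c, y] (EFin \o G i).
  by apply: locally_integrable_from_iter.
have cv : continuous (fun x => u x - G k.+1 x).
  by move=> x; apply: cvgB; [exact: cu|exact: cG].
have [phi tphi|p sp pE] := du_bois_reymond c d cd k.+1 _ cv.
  have [_ cphi phi0] := tphi.
  have cphi0 : continuous phi by exact: (cphi 0).
  have cphin : continuous (derive1n k.+1 phi) by exact: cphi.
  have restr (w psi : R -> R) : (forall x, (x <= c) || (d <= x) -> psi x = 0) ->
      \int[mu]_x (w x * psi x) = \int[mu]_(x in `[c, d]) (w x * psi x).
    move=> psi0; rewrite [RHS]Rintegral_mkcond; apply: eq_Rintegral => x _.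
    rewrite patchE mem_setE in_itv/=; case: ifPn => //.
    rewrite negb_and -!ltNge => cdx; rewrite psi0 ?mulr0//.
    by case/orP : cdx => /ltW ->; rewrite ?orbT.
  have := wd phi (test_function_on_test _ _ _ _ tphi).
  rewrite !restr => [|x xcd|x xcd]; [|exact: (phi0 0)|exact: phi0].
  rewrite -(iter_primitive_by_parts c d cd)// => wdE.
  transitivity (\int[mu]_(x in `[c, d])
      (u x * derive1n k.+1 phi x - G k.+1 x * derive1n k.+1 phi x)).
    by apply: eq_Rintegral => x _; rewrite mulrBl.
  rewrite RintegralB//; first by rewrite wdE subrr.
  + by apply: continuous_integrable_itv => x; apply: cvgM; [exact: cu|exact: cphin].
  + by apply: continuous_integrable_itv => x; apply: cvgM; [exact: cG|exact: cphin].
exists (fun i x => p^`(i).[x] + G (k.+1 - i)%N x); split.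
- by move=> x xcd; rewrite derivn0 subn0 -pE// subrK.
- move=> i x ik /andP[cx xd]; rewrite subSS subSn ?(ltnW ik)//.
  have dp : is_derive x 1 (horner p^`(i)) p^`(i.+1).[x].
    by rewrite derivnS; exact: is_derive_horner.
  have [j ->] : exists j, (k - i)%N = j.+1.
    by exists (k - i).-1; rewrite prednK// subn_gt0.
  have dG := is_derive_primitive c _ x (fun y => iG y j.+1) cx (cG j x).
  exact: is_deriveD dp dG.
- move=> x y cx xy yd; rewrite subSn// subnn.
  have /size1_polyC -> : (size p^`(k) <= 1)%N.
    apply/leq_sizeP => j j1; rewrite coef_derivn nth_default ?mul0rn//.
    by rewrite (leq_trans sp)// -addn1 leq_add2l.
  rewrite !hornerC opprD addrACA subrr add0r /G /= /primitive Rintegral_itvB//.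
  by rewrite bnd_simp ltW.
Qed.

End sobolev_representation.

(** * Polynomials on a cell *)

Section legendre.
Context {R : realType}.
Local Notation mu := (@lebesgue_measure R).
Implicit Types (p q e s : {poly R}) (k n : nat).

Definition antiderivp p : {poly R} :=
  \poly_(i < (size p).+1) (if i is j.+1 then p`_j / j.+1%:R else 0).

Lemma deriv_antiderivp p : (antiderivp p)^`() = p.
Proof.
apply/polyP => i; rewrite coef_deriv coef_poly ltnS; case: ltnP => [ip|pi].
  by rewrite -[LHS]mulr_natr divfK// pnatr_eq0.
by rewrite mul0rn nth_default.
Qed.

Lemma Rintegral_horner p (x y : R) : x <= y ->
  \int[mu]_(t in `[x, y]) p.[t] = (antiderivp p).[y] - (antiderivp p).[x].
Proof.
move=> xy; apply: Rintegral_is_derive => //; last exact: continuous_horner.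
by move=> t; rewrite -{2}(deriv_antiderivp p); exact: is_derive_horner.
Qed.

Definition integral01 p : R := \int[mu]_(t in `[0, 1]) p.[t].

Lemma integral01_deriv p : integral01 p^`() = p.[1] - p.[0].
Proof. by apply: Rintegral_is_derive => //; exact: continuous_horner. Qed.

Lemma integral01D p q : integral01 (p + q) = integral01 p + integral01 q.
Proof.
rewrite /integral01 -RintegralD//.
- by apply: eq_Rintegral => t _; rewrite hornerD.
- by apply: continuous_integrable_itv; exact: continuous_horner.
- by apply: continuous_integrable_itv; exact: continuous_horner.
Qed.

Lemma integral01Z (a : R) p : integral01 (a *: p) = a * integral01 p.
Proof.
rewrite /integral01 -RintegralZl//; first by apply: eq_Rintegral => t _; rewrite hornerZ.
by apply: continuous_integrable_itv; exact: continuous_horner.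
Qed.

Lemma integral010 : integral01 0 = 0.
Proof. by rewrite -[0 in LHS](scale0r 0) integral01Z mul0r. Qed.

Lemma integral01_sum n (F : 'I_n -> {poly R}) :
  integral01 (\sum_(i < n) F i) = \sum_(i < n) integral01 (F i).
Proof.
elim: n F => [|n IHn] F; first by rewrite !big_ord0 integral010.
by rewrite !big_ord_recr/= integral01D IHn.
Qed.

(** The points 1 / (i + 2) with i below the size of [p] are already too many roots. *)
Lemma poly_eq0_itv01 p : (forall t, 0 < t < 1 -> p.[t] = 0) -> p = 0.
Proof.
move=> p0; apply/eqP/negPn/negP => pn0.
pose r (i : nat) : R := (i.+2%:R)^-1.
have r_inj : injective r.
  by move=> i j /invr_inj/eqP; rewrite eqr_nat !eqSS => /eqP.
have := @max_poly_roots _ p [seq r i | i <- iota 0 (size p)] pn0.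
rewrite map_inj_uniq// iota_uniq size_map size_iota ltnn => H.
suff : false by []; apply: H => //; apply/allP => _ /mapP[i _ ->]; apply/eqP/p0.
by rewrite invr_gt0 ltr0n/= invf_lt1 ?ltr0n// ltr1n.
Qed.

Lemma integral01_sqr_eq0 p : integral01 (p * p) = 0 -> p = 0.
Proof.
move=> p0; apply: poly_eq0_itv01 => t t01.
have : (p * p).[t] = 0.
  apply: (Rintegral_continuous_ge0_eq0 0 1 (horner (p * p)) _ _ p0 t t01).
  - exact: continuous_horner.
  - by move=> x; rewrite hornerM -expr2 sqr_ge0.
by rewrite hornerM => /eqP; rewrite mulf_eq0 orbb => /eqP.
Qed.

(** Repeated integration by parts: each step lowers the degree of [q], and the boundary terms
    vanish. *)
Lemma integral01_derivn_mul n p q :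
  (forall i, (i < n)%N -> p^`(i).[0] = 0 /\ p^`(i).[1] = 0) ->
  (size q <= n)%N -> integral01 (p^`(n) * q) = 0.
Proof.
elim: n q => [|n IHn] q p0 sq.
  by move: sq; rewrite leqn0 size_poly_eq0 => /eqP ->; rewrite mulr0 integral010.
have [pn0 pn1] := p0 n (ltnSn n).
have := integral01_deriv (p^`(n) * q).
rewrite derivM -derivnS integral01D !hornerM pn0 pn1 !mul0r subrr.
rewrite (IHn q^`()) ?addr0//; first by move=> i /leqW/p0.
have [->|q0] := eqVneq q 0; first by rewrite deriv0 size_poly0.
by rewrite -ltnS (leq_trans (lt_size_deriv q0)).
Qed.

(* Rodrigues' formula for the Legendre polynomial shifted to [0, 1] *)
Definition legendre n : {poly R} :=
  (n`!%:R)^-1 *: (('X * ('X - 1)) ^+ n)^`(n).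

Lemma legendre_core_coef n i : (('X * ('X - 1)) ^+ n : {poly R})`_i =
  if (i < n)%N then 0 else (('X - 1) ^+ n : {poly R})`_(i - n).
Proof. by rewrite exprMn coefXnM. Qed.

Lemma derivn_horner0 n p : p^`(n).[0] = n`!%:R * p`_n.
Proof. by rewrite horner_coef0 coef_derivn addn0 ffactnn mulr_natl. Qed.

Lemma derivn_comp_onem n p :
  (p \Po (1 - 'X))^`(n) = (-1) ^+ n *: (p^`(n) \Po (1 - 'X)).
Proof.
elim: n => [|n IHn]; first by rewrite expr0 scale1r.
rewrite derivnS IHn derivZ deriv_comp -derivnS derivB -polyC1 derivC derivX sub0r.
by rewrite mulrN mulr1 scalerN exprS mulN1r scaleNr polyC1.
Qed.

Lemma legendre_core_onem n :
  ('X * ('X - 1)) ^+ n \Po (1 - 'X) = ('X * ('X - 1)) ^+ n :> {poly R}.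
Proof.
rewrite rmorphXn/= rmorphM/= rmorphB/= comp_polyX rmorph1.
by congr (_ ^+ n); ring.
Qed.

(** The core is invariant under t -> 1 - t and each derivative contributes a sign. Values at 1 are
    thus reduced to values at 0, that is, to coefficients. *)
Lemma derivn_legendre_core1 n i : (('X * ('X - 1)) ^+ n)^`(i).[1] =
  (-1) ^+ i * (('X * ('X - 1)) ^+ n : {poly R})^`(i).[0].
Proof.
rewrite -{1}legendre_core_onem derivn_comp_onem hornerZ horner_comp.
by rewrite !hornerE subrr.
Qed.

Lemma size_legendre n : (size (legendre n) <= n.+1)%N.
Proof.
rewrite (leq_trans (size_scale_leq _ _))//; apply/leq_sizeP => j nj.
rewrite coef_derivn nth_default ?mul0rn// exprMn.
rewrite (leq_trans (size_polyMleq _ _))// size_polyXn -polyC1 size_exp_XsubC.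
by rewrite addSn/= leq_add2l.
Qed.

Lemma legendre_orth n q : (size q <= n)%N -> integral01 (legendre n * q) = 0.
Proof.
move=> sq; rewrite -scalerAl integral01Z integral01_derivn_mul ?mulr0// => i lin.
by rewrite derivn_legendre_core1 derivn_horner0 legendre_core_coef lin !mulr0.
Qed.

Lemma legendre0 n : (legendre n).[0] = (-1) ^+ n.
Proof.
rewrite hornerZ derivn_horner0 mulKf ?pnatr_eq0 -?lt0n ?fact_gt0//.
rewrite legendre_core_coef ltnn subnn -horner_coef0 horner_exp.
by rewrite !hornerE.
Qed.

Lemma legendre1 n : (legendre n).[1] = 1.
Proof.
have := legendre0 n; rewrite /legendre !hornerZ derivn_legendre_core1 mulrCA => ->.
by rewrite -exprD addnn -signr_odd odd_double.
Qed.

(** The derivative of order n + 1 of the core at 0 reads off its coefficient of X^(n + 1), which is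
    the coefficient of X in (X - 1)^n. *)
Lemma deriv_legendre0 n : (legendre n)^`().[0] = - (-1) ^+ n * (n * n.+1)%:R.
Proof.
have c1 : (('X - 1) ^+ n : {poly R})`_1 = - (-1) ^+ n * n%:R.
  rewrite -[LHS]mulr1n -coef_deriv -horner_coef0 deriv_exp derivB derivX -polyC1.
  rewrite derivC subr0 mul1r hornerMn horner_exp !hornerE -mulr_natr.
  by case: n => [|n]; rewrite ?mulr0// exprS mulN1r opprK.
rewrite derivZ -derivnS hornerZ derivn_horner0 legendre_core_coef ltnNge leqnSn /=.
rewrite subSnn c1 factS natrM -mulrA mulrCA mulKf ?pnatr_eq0 -?lt0n ?fact_gt0//.
by rewrite mulrCA -natrM mulnC.
Qed.

Lemma deriv_legendre1 n : (legendre n)^`().[1] = (n * n.+1)%:R.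
Proof.
have := deriv_legendre0 n.
rewrite /legendre derivZ !hornerZ -derivnS derivn_legendre_core1 mulrCA => ->.
rewrite exprS mulrA mulN1r mulrNN -exprD addnn -signr_odd odd_double.
by rewrite mul1r.
Qed.

End legendre.

Section local_polynomials.
Context {R : realType}.
Implicit Types (p q e s : {poly R}) (k n : nat).

Lemma poly_sum_wide n p : (size p <= n)%N -> p = \sum_(i < n) p`_i *: 'X^i.
Proof.
move=> sp; rewrite -poly_def; apply/polyP => i; rewrite coef_poly.
by case: ltnP => // ni; rewrite nth_default// (leq_trans sp).
Qed.

Lemma double_root1 p : p.[1] = 0 -> p^`().[1] = 0 ->
  exists s, p = ('X - 1) ^+ 2 * s.
Proof.
have root1 q : q.[1] = 0 -> exists s, q = ('X - 1) * s.
  move=> /rootP/factor_theorem[s ->]; exists s; by rewrite mulrC polyC1.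
move=> /root1[q ->]; rewrite derivM derivB derivX -polyC1 derivC subr0 mul1r !hornerE.
by rewrite subrr mul0r addr0 => /root1[s ->]; exists s; rewrite mulrA -expr2.
Qed.

Lemma horner_lin2 (y1 y2 : R) p q x :
  (y1 *: p + y2 *: q).[x] = y1 * p.[x] + y2 * q.[x].
Proof. by rewrite hornerD !hornerZ. Qed.

Lemma deriv_lin2 (y1 y2 : R) p q :
  (y1 *: p + y2 *: q)^`() = y1 *: p^`() + y2 *: q^`().
Proof. by rewrite derivD !derivZ. Qed.

(** The coefficients are chosen so that the remainder has a double root at 1, hence is (X - 1)^2 s
    with s of size at most k. Its orthogonality to s says that the square of (X - 1) s has integral
    0. *)
Lemma legendre_decomp k e : (size e <= k.+2)%N ->
  (forall q, (size q <= k)%N -> integral01 (e * q) = 0) ->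
  exists y1 y2 : R, e = y1 *: legendre k + y2 *: legendre k.+1.
Proof.
move=> se eorth.
(* Solves y1 + y2 = e(1) and k (k + 1) y1 + (k + 1) (k + 2) y2 = e'(1), whose determinant is 2 (k +
   1). *)
pose y2 := (e^`().[1] - (k * k.+1)%:R * e.[1]) / (2 * k.+1%:R).
pose y1 := e.[1] - y2.
exists y1, y2; apply/eqP; rewrite -subr_eq0; apply/eqP.
set r := _ - _.
have rorth q : (size q <= k)%N -> integral01 (r * q) = 0.
  move=> sq; have -> : r * q = e * q +
      (- y1) *: (legendre k * q) + (- y2) *: (legendre k.+1 * q).
    by rewrite /r mulrBl mulrDl -!scalerAl !scaleNr opprD addrA.
  rewrite !integral01D !integral01Z eorth// !legendre_orth//; last exact: leqW.
  by rewrite !mulr0 !addr0.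
have r1 : r.[1] = 0.
  by rewrite /r hornerD hornerN horner_lin2 !legendre1 /y1; ring.
have r'1 : r^`().[1] = 0.
  rewrite /r derivB deriv_lin2 hornerD hornerN horner_lin2 !deriv_legendre1.
  rewrite /y1 /y2 !natrM; field.
  by rewrite nat1r pnatr_eq0.
have [s rE] := double_root1 r r1 r'1.
have sr : (size r <= k.+2)%N.
  rewrite (leq_trans (size_polyD _ _))// geq_max se size_polyN.
  rewrite (leq_trans (size_polyD _ _))// geq_max; apply/andP; split.
    by rewrite (leq_trans (size_scale_leq _ _))// ltnW// ltnS size_legendre.
  by rewrite (leq_trans (size_scale_leq _ _))// size_legendre.
have [s0|s0] := eqVneq s 0; first by rewrite rE s0 mulr0.
have ss : (size s <= k)%N.
  move: sr; rewrite rE size_monicM -?polyC1 ?monic_exp ?monicXsubC//.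
  by rewrite size_exp_XsubC.
have : ('X - 1) * s = 0.
  by apply: integral01_sqr_eq0; rewrite -(rorth s ss) rE; congr integral01; ring.
by rewrite rE expr2 -mulrA => ->; rewrite mulr0.
Qed.

(** The value at 1 forces y1 = - y2. The two Legendre polynomials have slopes of opposite sign at 0,
    so these contributions cannot cancel and y2 = 0. This is the unisolvence behind [local_lift]. *)
Lemma legendre_decomp_eq0 k e : (size e <= k.+2)%N ->
  (forall i, (i < k)%N -> integral01 (e * 'X^i) = 0) ->
  e.[1] = 0 -> e^`().[0] = 0 -> e = 0.
Proof.
move=> se eorth e1 e0.
have [q sq|y1 [y2 eE]] := legendre_decomp k e se.
  rewrite (poly_sum_wide k q sq) big_distrr /= integral01_sum big1// => i _.
  by rewrite -scalerAr integral01Z eorth ?mulr0.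
have y12 : y1 = - y2.
  apply/eqP; rewrite -addr_eq0; apply/eqP.
  by move: e1; rewrite eE horner_lin2 !legendre1 !mulr1.
move: e0; rewrite eE deriv_lin2 horner_lin2 !deriv_legendre0 exprS.
rewrite y12 => H; have y20 : y2 = 0.
  apply/eqP; have : y2 * (-1) ^+ k * ((k * k.+1)%:R + (k.+1 * k.+2)%:R) = 0.
    by rewrite -[RHS]H; ring.
  move/eqP; rewrite !mulf_eq0 signr_eq0 orbF => /orP[//|].
  by rewrite -natrD pnatr_eq0 addn_eq0 muln_eq0 andbF.
by rewrite y20 oppr0 !scale0r addr0.
Qed.

Lemma horner_norm_bound n p (x B : R) : (size p <= n)%N -> `|x| <= 1 ->
  (forall i, `|p`_i| <= B) -> `|p.[x]| <= n%:R * B.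
Proof.
move=> sp x1 pB; rewrite (horner_coef_wide _ sp).
rewrite (le_trans (ler_norm_sum _ _ _))//.
apply: (@le_trans _ _ (\sum_(i < n) B)); last by rewrite sumr_const card_ord mulr_natl.
apply: ler_sum => i _.
rewrite normrM normrX (le_trans _ (pB i))// ler_piMr//.
by rewrite exprn_ile1.
Qed.

(* The derivative at 0 is prescribed to vanish because u is later replaced by
   its remainder in the Taylor expansion at the left end of the cell. *)
Lemma local_lift k : exists2 K : R, 0 <= K &
  forall (m : nat -> R) (v B : R), `|v| <= B -> (forall i, (i < k)%N -> `|m i| <= B) ->
  exists Z : {poly R}, [/\ (size Z <= k.+2)%N,
    forall i, (i < k)%N -> integral01 (Z * 'X^i) = m i,
    Z.[1] = v /\ Z^`().[0] = 0,
    forall t, `|t| <= 1 -> `|Z.[t]| <= K * B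
  & `|Z^`().[1]| <= K * B].
Proof.
(* The k + 2 functionals to be prescribed: k moments, the value at 1 and the derivative at 0. Their
   matrix [A] on the monomials is invertible by [legendre_decomp_eq0]. *)
pose Phi (j : 'I_k.+2) p : R :=
  if (j < k)%N then integral01 (p * 'X^j)
  else if j == k :> nat then p.[1] else p^`().[0].
have PhiZ j a p : Phi j (a *: p) = a * Phi j p.
  rewrite /Phi; case: ifP => _; first by rewrite -scalerAl integral01Z.
  by case: ifP => _; rewrite ?derivZ hornerZ.
have PhiD j p q : Phi j (p + q) = Phi j p + Phi j q.
  rewrite /Phi; case: ifP => _; first by rewrite mulrDl integral01D.
  by case: ifP => _; rewrite ?derivD hornerD.
have Phi_sum j n (F : 'I_n -> {poly R}) :
    Phi j (\sum_(i < n) F i) = \sum_(i < n) Phi j (F i).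
  elim: n F => [|n IHn] F; last by rewrite !big_ord_recr/= PhiD IHn.
  by rewrite !big_ord0 -(scale0r 0) PhiZ mul0r.
pose A := \matrix_(i < k.+2, j < k.+2) Phi j ('X^i).
have PhiE (c : 'rV[R]_k.+2) j : Phi j (rVpoly c) = (c *m A) 0 j.
  rewrite (poly_sum_wide k.+2 (rVpoly c)) ?size_poly// Phi_sum mxE.
  by apply: eq_bigr => i _; rewrite PhiZ mxE coef_rVpoly_ord.
have Aunit : A \in unitmx.
  rewrite unitmxE unitfE; apply/det0P => -[c cn0 cA].
  have Phi0 j : Phi j (rVpoly c) = 0 by rewrite PhiE cA mxE.
  have c0 : rVpoly c = 0.
    apply: (legendre_decomp_eq0 k); first exact: size_poly.
    - move=> i ik; have ik2 : (i < k.+2)%N by rewrite ltnW// ltnW.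
      by have := Phi0 (Ordinal ik2); rewrite /Phi /= ik.
    - have kk : (k < k.+2)%N by [].
      by have := Phi0 (Ordinal kk); rewrite /Phi /= ltnn eqxx.
    - have kk : (k.+1 < k.+2)%N by [].
      by have := Phi0 (Ordinal kk); rewrite /Phi /= ltnNge leqnSn/= gtn_eqF.
  by move: cn0; rewrite -[c]rVpolyK c0 linear0 eqxx.
pose K0 : R := \sum_i \sum_j `|invmx A i j|.
have K00 : 0 <= K0 by apply: sumr_ge0 => i _; apply: sumr_ge0.
(* One factor k + 2 counts the coefficients, the other bounds the exponents that differentiation
   brings down. *)
exists (k.+2%:R * k.+2%:R * K0) => [|m v B vB mB].
  by rewrite mulr_ge0// mulr_ge0.
have B0 : 0 <= B by rewrite (le_trans _ vB).
pose rhs : 'rV[R]_k.+2 := \row_j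
  (if (j < k)%N then m j else if j == k :> nat then v else 0).
pose Z := rVpoly (rhs *m invmx A).
have PhiZE j : Phi j Z = rhs 0 j by rewrite PhiE mulmxKV.
have sZ : (size Z <= k.+2)%N by exact: size_poly.
have rB j : `|rhs 0 j| <= B.
  by rewrite mxE; case: ifP => [/mB//|_]; case: ifP => // _; rewrite normr0.
have ZB i : `|Z`_i| <= K0 * B.
  have [ik|ki] := ltnP i k.+2; last by rewrite nth_default ?(leq_trans sZ)// normr0 mulr_ge0.
  rewrite -[i]/(nat_of_ord (Ordinal ik)) coef_rVpoly_ord mxE.
  rewrite (le_trans (ler_norm_sum _ _ _))// mulr_suml ler_sum// => l _.
  rewrite normrM mulrC ler_pM// (bigD1 (Ordinal ik))//= lerDl.
  exact: sumr_ge0.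
have [k1 k2] : (k < k.+2)%N /\ (k.+1 < k.+2)%N by [].
exists Z; split => //.
- move=> i ik; have ik2 : (i < k.+2)%N by rewrite ltnW// ltnW.
  by have := PhiZE (Ordinal ik2); rewrite /Phi mxE /= ik.
- split; first by have := PhiZE (Ordinal k1); rewrite /Phi mxE /= ltnn eqxx.
  by have := PhiZE (Ordinal k2); rewrite /Phi mxE /= ltnNge leqnSn/= gtn_eqF.
- move=> t t1; rewrite (le_trans (horner_norm_bound k.+2 Z t _ sZ t1 ZB))//.
  rewrite -!mulrA ler_wpM2l// ler_peMl ?mulr_ge0// ler1n//.
- have sZ' : (size Z^`() <= k.+2)%N.
    by rewrite (leq_trans (size_poly _ _))// (leq_trans (leq_pred _)).
  rewrite (le_trans (horner_norm_bound k.+2 Z^`() 1 (k.+2%:R * (K0 * B)) sZ' _ _))//.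
  + by rewrite normr1.
  + move=> i; rewrite coef_deriv; have [ik|ki] := ltnP i.+1 k.+2; last first.
      by rewrite nth_default ?(leq_trans sZ)// mul0rn normr0 !mulr_ge0.
    by rewrite normrMn -[leLHS]mulr_natl ler_pM// ler_nat ltnW.
  + by rewrite !mulrA.
Qed.

End local_polynomials.

(** * The periodic recursion *)

Section cyclic_recursion.
Context {R : realType} {V : normedModType R}.
Variable N : nat.
Implicit Types (z g : nat -> V) (l G : R).

Lemma exists_max_norm z : (0 < N)%N ->
  exists2 j, (j < N)%N & forall i, (i < N)%N -> `|z i| <= `|z j|.
Proof.
move=> N0; have /= := @arg_maxP _ _ 'I_N (Ordinal N0) xpredT (fun i => `|z i|) isT.
by case=> j _ jmax; exists j => // i iN; exact: (jmax (Ordinal iN)).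
Qed.

(** At an index i where the norm is maximal, the recursion gives |z i| <= |l| |z i| + G. *)
Lemma cyclic_contraction l G z g : `|l| < 1 ->
  (forall j, (j < N)%N -> z j = l *: z (j.+1 %% N)%N + g j) ->
  (forall j, (j < N)%N -> `|g j| <= G) ->
  forall j, (j < N)%N -> `|z j| <= G / (1 - `|l|).
Proof.
move=> l1 zE gG j jN; have N0 : (0 < N)%N by exact: leq_ltn_trans jN.
have [i iN imax] := exists_max_norm z N0.
rewrite (le_trans (imax j jN))// ler_pdivlMr ?subr_gt0//.
rewrite mulrBr mulr1 lerBlDr {1}zE// (le_trans (ler_normD _ _))// addrC lerD ?gG//.
by rewrite normrZ mulrC ler_wpM2r// imax// ltn_pmod.
Qed.

(** The recursion is read backwards, at the cyclic predecessor i' of an index i of maximal norm: |l|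
    |z i| <= |z i'| + G <= |z i| + G. *)
Lemma cyclic_expansion l G z g : 1 < `|l| ->
  (forall j, (j < N)%N -> z j = l *: z (j.+1 %% N)%N + g j) ->
  (forall j, (j < N)%N -> `|g j| <= G) ->
  forall j, (j < N)%N -> `|z j| <= G / (`|l| - 1).
Proof.
move=> l1 zE gG j jN; have N0 : (0 < N)%N by exact: leq_ltn_trans jN.
have [i iN imax] := exists_max_norm z N0.
rewrite (le_trans (imax j jN))// ler_pdivlMr ?subr_gt0//.
pose i' := ((i + N.-1) %% N)%N.
have i'N : (i' < N)%N by rewrite ltn_pmod.
have ii' : (i'.+1 %% N)%N = i.
  by rewrite -addn1 modnDml -addnA addn1 prednK// modnDr modn_small.
have : l *: z i = z i' - g i' by rewrite (zE i')// ii' addrK.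
move=> /(congr1 (fun v => `|v|)); rewrite normrZ => E.
rewrite mulrBr mulr1 mulrC E lerBlDl (le_trans (ler_normB _ _))// lerD ?imax ?gG//.
Qed.

End cyclic_recursion.

(** * Spectral decomposition of the transfer matrix between neighbouring cells *)

Section two_by_two.
Context {R : realType}.
Implicit Types (x y z t u v B : R) (A : 'M[R]_2) (w : 'cV[R]_2).

Lemma eq_mx22 (A A' : 'M[R]_2) : A 0 0 = A' 0 0 -> A 0 1 = A' 0 1 ->
  A 1 0 = A' 1 0 -> A 1 1 = A' 1 1 -> A = A'.
Proof.
move=> a00 a01 a10 a11; apply/matrixP => i j.
have I2 (l : 'I_2) : l = 0 \/ l = 1.
  by case: l => [[|[|//]]] ?; [left|right]; exact/val_inj.
by case: (I2 i) => ->; case: (I2 j) => ->.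
Qed.

Lemma eq_cv2 w w' : w 0 0 = w' 0 0 -> w 1 0 = w' 1 0 -> w = w'.
Proof.
move=> a0 a1; apply/matrixP => i j; rewrite (ord1 j).
have I2 (l : 'I_2) : l = 0 \/ l = 1.
  by case: l => [[|[|//]]] ?; [left|right]; exact/val_inj.
by case: (I2 i) => ->.
Qed.

Lemma mul_mx22E A A' i j : (A *m A') i j = A i 0 * A' 0 j + A i 1 * A' 1 j.
Proof. by rewrite mxE big_ord_recl big_ord1; congr (_ * _ + A i _ * A' _ j); exact/val_inj. Qed.

Lemma mul_mxcv2E A w i : (A *m w) i 0 = A i 0 * w 0 0 + A i 1 * w 1 0.
Proof. by rewrite mxE big_ord_recl big_ord1; congr (_ * _ + A i _ * w _ 0); exact/val_inj. Qed.

Lemma norm_cv2_le x y B : `|x| <= B -> `|y| <= B -> `|cv2 x y| <= B.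
Proof.
move=> xB yB; rewrite -[leLHS]/(mx_norm _) mx_normrE; apply: bigmax_le; first exact: le_trans xB.
by move=> i _; rewrite mxE; case: ifP.
Qed.

Lemma norm_entry_le w i : `|w i 0| <= `|w|.
Proof.
by rewrite -[leRHS]/(mx_norm w) mx_normrE; apply: (le_bigmax _ (fun i => `|w i.1 i.2|) (i, 0)).
Qed.

End two_by_two.

Section block_matrices.
Context {R : realType}.
Variables (k : nat) (h alpha1 beta1 beta2 : R).
Hypotheses (k0 : (0 < k)%N) (h0 : 0 < h).
Local Notation K := (k%:R : R).
Local Notation Gam := (Gam k h alpha1 beta1 beta2).
Local Notation Lam := (Lam k h alpha1 beta1 beta2).
Local Notation c2 := (c2 k h alpha1).
Local Notation b1 := (b1 k h alpha1 beta1 beta2).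
Local Notation b2 := (b2 k h alpha1 beta1 beta2).
Local Notation disc := (disc k h alpha1 beta1 beta2).
Local Notation lambda1 := (lambda1 k h alpha1 beta1 beta2).
Local Notation lambda2 := (lambda2 k h alpha1 beta1 beta2).
Local Notation V1 := (V1 k h alpha1 beta1 beta2).
Local Notation V2 := (V2 k h : 'cV[R]_2).
Local Notation Q1 := (Q1 k h alpha1 beta1 beta2).
Local Notation sgn := ((-1) ^+ k.+1 : R).

Let K0 : K != 0. Proof. by rewrite pnatr_eq0 -lt0n. Qed.
Let hn0 : h != 0. Proof. by rewrite gt_eqF. Qed.

Lemma mx22E (x y z t : R) : ((mx22 x y z t 0 0 = x) * (mx22 x y z t 0 1 = y) *
  (mx22 x y z t 1 0 = z) * (mx22 x y z t 1 1 = t))%type.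
Proof. by rewrite !mxE. Qed.

Lemma cv2E (x y : R) : ((cv2 x y 0 0 = x) * (cv2 x y 1 0 = y))%type.
Proof. by rewrite !mxE. Qed.

(** Up to a scalar, the trace-free part of [transfer]. Once |Lam| < |Gam|, its eigenvalues are
    [disc] and - [disc]. *)
Definition traceless : 'M[R]_2 := mx22 c2 (b1 + b2) (b1 - b2) (- c2).

(* This is - A^-1 B for the block-circulant system A y_j + B y_(j+1) = f_j of the
   interface conditions. *)
Definition transfer : 'M[R]_2 := (sgn / Lam) *: (Gam%:M + traceless).

(** The spectral projection of [transfer] for [lambda1]; it agrees with the regular branch of
    [Q1]. *)
Definition spectral : 'M[R]_2 := (2 * disc)^-1 *: (traceless + disc%:M).

(** In terms of determinants: [transfer] has determinant 1 when Lam is nonzero. *)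
Lemma quadratic_relation : c2 ^+ 2 + (b1 + b2) * (b1 - b2) = Gam ^+ 2 - Lam ^+ 2.
Proof. by rewrite /Defs.c2 /Defs.b1 /Defs.b2 /Defs.Gam /Defs.Lam; field. Qed.

Lemma sgn_sqr : sgn * sgn = 1.
Proof. by rewrite -exprD addnn -signr_odd odd_double. Qed.

Hypothesis LamGam : `|Lam| < `|Gam|.

Lemma disc_gt0 : 0 < disc.
Proof.
rewrite sqrtr_gt0 subr_gt0 -[ltLHS]real_normK ?num_real// -[ltRHS]real_normK ?num_real//.
by rewrite ltr_pXn2r// nnegrE.
Qed.

Lemma disc_sqr : disc ^+ 2 = Gam ^+ 2 - Lam ^+ 2.
Proof. by rewrite sqr_sqrtr// ltW// -sqrtr_gt0 disc_gt0. Qed.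

Lemma traceless_sqr : traceless *m traceless = (disc ^+ 2)%:M.
Proof.
have q := quadratic_relation.
by apply: eq_mx22; rewrite mul_mx22E !mx22E disc_sqr -q !mxE/= ?mulr1n ?mulr0n; ring.
Qed.

(** With T the traceless matrix and d = [disc], T^2 = d^2 gives (T + d) (Gam + T) = (Gam + d) (T +
    d). *)
Lemma spectral_transfer : spectral *m transfer = lambda1 *: spectral.
Proof.
rewrite /spectral /transfer /Defs.lambda1 -!scalemxAl -!scalemxAr !scalerA.
rewrite mulmxDl !mulmxDr traceless_sqr -!scalar_mxM !mul_scalar_mx !mul_mx_scalar.
by apply: eq_mx22; rewrite !mxE/= ?mulr1n ?mulr0n; ring.
Qed.

Lemma onem_spectral_transfer :
  (1%:M - spectral) *m transfer = lambda2 *: (1%:M - spectral).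
Proof.
have d0 : disc != 0 by rewrite gt_eqF// disc_gt0.
have -> : 1%:M - spectral = (2 * disc)^-1 *: (disc%:M - traceless).
  by apply: eq_mx22; rewrite !mxE/= ?mulr1n ?mulr0n; field.
rewrite /transfer /Defs.lambda2 -!scalemxAl -!scalemxAr !scalerA.
rewrite mulmxBl !mulmxDr traceless_sqr -!scalar_mxM !mul_scalar_mx !mul_mx_scalar.
by apply: eq_mx22; rewrite !mxE/= ?mulr1n ?mulr0n; ring.
Qed.

Hypothesis Lam0 : Lam != 0.

Lemma lambda12 : lambda1 * lambda2 = 1.
Proof.
rewrite /Defs.lambda1 /Defs.lambda2.
transitivity (sgn * sgn * (Gam ^+ 2 - disc ^+ 2) / Lam ^+ 2); first by field.
by rewrite sgn_sqr disc_sqr; field.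
Qed.

(** Gam and - disc have the same sign, so that |lambda2| = (|Gam| + disc) / |Lam|. *)
Lemma lambda2_gt1 : Gam < 0 -> 1 < `|lambda2|.
Proof.
move=> G0; rewrite /Defs.lambda2 normrM normrM normfV normrX normrN1 expr1n mul1r.
rewrite mulrC ltr_pdivlMr ?normr_gt0// mul1r (lt_le_trans LamGam)//.
by have d0 := disc_gt0; rewrite (ltr0_norm G0) ltr0_norm; lra.
Qed.

Lemma lambda1_gt1 : 0 < Gam -> 1 < `|lambda1|.
Proof.
move=> G0; rewrite /Defs.lambda1 normrM normrM normfV normrX normrN1 expr1n mul1r.
rewrite mulrC ltr_pdivlMr ?normr_gt0// mul1r (lt_le_trans LamGam)//.
by have d0 := disc_gt0; rewrite (gtr0_norm G0) gtr0_norm; lra.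
Qed.

(* The exceptional branch of Q1 exchanges the two spectral projections. *)
Lemma Q1_spectral : Q1 = spectral \/ Q1 = 1%:M - spectral.
Proof.
have d0 : disc != 0 by rewrite gt_eqF// disc_gt0.
rewrite /Defs.Q1; case: ifPn => [/andP[/eqP bb cl0]|_]; last first.
  left; rewrite /spectral; congr (_ *: _).
  by apply: eq_mx22; rewrite !mxE/= ?mulr1n ?mulr0n; ring.
(* In the exceptional branch [quadratic_relation] reduces to disc^2 = c2^2, and c2 is negative. *)
have dE : disc = - c2.
  apply: (@pexpIrn _ 2) => //; rewrite ?nnegrE ?ltW ?disc_gt0 ?oppr_gt0//.
  by rewrite disc_sqr -quadratic_relation mulrC bb addr0 sqrrN.
right; rewrite /spectral dE.
have c0 : c2 != 0 by rewrite lt_eqF.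
by apply: eq_mx22; rewrite !mxE/= ?mulr1n ?mulr0n; field.
Qed.

(** The coefficients (K + 1) / 2 and (K - 1) / 2 give, up to sign, the value 1 and the derivative 0
    at the left end of the cell. This is the perturbation that z causes in the interface conditions,
    so its effect [V1] is the transfer of these coefficients. *)
Lemma V1_transfer : V1 = transfer *m (- sgn *: cv2 ((K + 1) / 2) ((K - 1) / 2)).
Proof.
rewrite /transfer -scalemxAl -scalemxAr scalerA.
have -> : sgn / Lam * - sgn = - Lam^-1.
  by rewrite mulrN mulrAC sgn_sqr mul1r.
rewrite /Defs.V1 scaleNr -scalerN; congr (_ *: _); apply: eq_cv2;
  rewrite [RHS]mxE mul_mxcv2E !mxE/= ?mulr1n ?mulr0n
    /Defs.c2 /Defs.b1 /Defs.b2 /Defs.Gam; field; by rewrite hn0.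
Qed.

(** Bounds the last bracket of the factor below by 1 / (2 K), so that it can absorb constants in
    [cyclic_projection_bound]. *)
Lemma norm_V2 : h^-1 * `|V2| = (2 * K)^-1.
Proof.
have p0 : 0 <= h / (2 * K) by apply: divr_ge0; [exact: ltW|exact: mulr_ge0].
have -> : `|V2| = h / (2 * K).
  apply/eqP; rewrite eq_le norm_cv2_le ?normrN ?ger0_norm//=.
  by have := norm_entry_le V2 1; rewrite mxE/= ger0_norm.
by field; rewrite K0 hn0.
Qed.

(* y1 + y2 and q y1 + p y2 are the left traces of y1 P_(k-1) + y2 P_k and of its
   derivative; the terms with y1' and y2' are the right traces on the next cell. *)
Lemma interface_solve (y1 y2 y1' y2' z z' : R) :
  let p := K * (K + 1) / h in let q := K * (K - 1) / h in
  (2^-1 + alpha1) * (y1 + y2) - beta2 * (q * y1 + p * y2)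
  + (2^-1 - alpha1) * (sgn * (y1' - y2') + z)
  + beta2 * (sgn * (- q * y1' + p * y2')) - beta2 * z' = 0 ->
  (2^-1 - alpha1) * (q * y1 + p * y2 + z') - beta1 * (y1 + y2)
  + (2^-1 + alpha1) * (sgn * (- q * y1' + p * y2'))
  + beta1 * (sgn * (y1' - y2') + z) = 0 ->
  cv2 y1 y2 = transfer *m cv2 y1' y2' - (z *: V1 + z' *: V2).
Proof.
move=> p q.
set E1 := (X in X = 0 -> _); set E2 := (X in _ -> X = 0 -> _) => E10 E20.
(* [D1] eliminates the left trace of the derivative and [D2] the left trace of the value; p D1 - D2
   and - q D1 + D2 then isolate Lam y1 and Lam y2. *)
have D1 : (2^-1 - alpha1) * E1 + beta2 * E2 = 0 by rewrite E10 E20 !mulr0 addr0.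
have D2 : beta1 * E1 + (2^-1 + alpha1) * E2 = 0 by rewrite E10 E20 !mulr0 addr0.
have entry (w1 w2 w3 : 'cV[R]_2) i :
    (w1 - (z *: w2 + z' *: w3)) i 0 = w1 i 0 - (z * w2 i 0 + z' * w3 i 0).
  by rewrite !mxE.
have T0 : (transfer *m cv2 y1' y2') 0 0 =
    sgn / Lam * ((Gam + c2) * y1' + (b1 + b2) * y2').
  by rewrite mul_mxcv2E !mxE/= ?mulr1n ?mulr0n; ring.
have T1 : (transfer *m cv2 y1' y2') 1 0 =
    sgn / Lam * ((b1 - b2) * y1' + (Gam - c2) * y2').
  by rewrite mul_mxcv2E !mxE/= ?mulr1n ?mulr0n; ring.
apply: eq_cv2; rewrite entry ?T0 ?T1 !cv2E.
- apply/eqP; rewrite -subr_eq0 -(inj_eq (mulfI Lam0)) mulr0; apply/eqP.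
  transitivity (p * ((2^-1 - alpha1) * E1 + beta2 * E2)
    - (beta1 * E1 + (2^-1 + alpha1) * E2)); last by rewrite D1 D2 mulr0 subr0.
  rewrite !mxE/= -/Lam.
  transitivity (Lam * y1 - sgn * ((Gam + c2) * y1' + (b1 + b2) * y2')
    + z * (- beta1 + K * (K + 1) / h * ((2^-1 - alpha1) ^+ 2 + beta1 * beta2))
    + Lam * z' * (- (h / (2 * K)))).
    by field; rewrite K0 hn0.
  rewrite /E1 /E2 /p /q /Defs.c2 /Defs.b1 /Defs.b2 /Defs.Gam /Defs.Lam.
  by field; rewrite K0 hn0.
- apply/eqP; rewrite -subr_eq0 -(inj_eq (mulfI Lam0)) mulr0; apply/eqP.
  transitivity (- q * ((2^-1 - alpha1) * E1 + beta2 * E2)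
    + (beta1 * E1 + (2^-1 + alpha1) * E2)); last by rewrite D1 D2 mulr0 addr0.
  rewrite !mxE/= -/Lam.
  transitivity (Lam * y2 - sgn * ((b1 - b2) * y1' + (Gam - c2) * y2')
    + z * (beta1 - K * (K - 1) / h * ((2^-1 - alpha1) ^+ 2 + beta1 * beta2))
    + Lam * z' * (h / (2 * K))).
    by field; rewrite K0 hn0.
  rewrite /E1 /E2 /p /q /Defs.c2 /Defs.b1 /Defs.b2 /Defs.Gam /Defs.Lam.
  by field; rewrite K0 hn0.
Qed.

End block_matrices.

Section cyclic_bound.
Context {R : realType}.

(* Makes the exchange of the projections in the exceptional Q1 harmless. *)
Lemma spectral_swap (Qa Qb P : 'M[R]_2) (mu nu : R) (v : 'cV[R]_2) :
  Qa + Qb = 1%:M -> Qa *m P = mu *: Qa -> Qb *m P = nu *: Qb ->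
  mu * nu = 1 -> 1 <= `|nu| -> `|Qa *m (P *m v)| <= `|v| + `|Qb *m (P *m v)|.
Proof.
move=> Q1 QaP QbP munu nu1; rewrite !mulmxA QaP QbP -!scalemxAl !normrZ.
have mu1 : `|mu| <= 1.
  by rewrite -(ler_pM2r (lt_le_trans ltr01 nu1)) -normrM munu normr1 mul1r.
rewrite (le_trans (ler_piMl _ mu1))//.
have -> : Qa *m v = v - Qb *m v by rewrite -[v in v - _]mul1mx -Q1 mulmxDl addrK.
by rewrite (le_trans (ler_normB _ _))// lerD2l ler_peMl.
Qed.

(** With w = 1 / (|nu| - 1), one has 1 / (1 - |mu|) = 1 + w and (|nu| + 1) / (|nu| - 1) = 1 + 2 w.
    The [Qa] part of y costs B A(Qa) (1 + w), the [Qb] part B A(Qb) w. As A(Qb) <= F + A(Qa), the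
    sum is at most B times A(Qa) (1 + 2 w) + F w. *)
Lemma cyclic_projection_bound (N : nat) (K h B mu nu : R) (Qa Qb Q' P : 'M[R]_2)
    (V1 V2 v0 : 'cV[R]_2) (y : nat -> 'cV[R]_2) (f g : nat -> R) :
  1 <= K -> 0 < h -> 0 <= B ->
  Qa + Qb = 1%:M -> Qa *m P = mu *: Qa -> Qb *m P = nu *: Qb ->
  mu * nu = 1 -> 1 < `|nu| -> V1 = P *m v0 -> `|v0| <= K ->
  h^-1 * `|V2| = (2 * K)^-1 -> Q' = Qa \/ Q' = Qb ->
  (forall j, (j < N)%N ->
    y j = P *m y (j.+1 %% N)%N + (f j *: V1 + g j *: V2)) ->
  (forall j, (j < N)%N -> `|f j| <= B) ->
  (forall j, (j < N)%N -> `|g j| <= B / h) ->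
  forall j, (j < N)%N -> `|y j| <= 9 * K ^+ 2 * B *
    (1 + (`|nu| + 1) / (`|nu| - 1) * (`|Q' *m V1| + h^-1 * `|Q' *m V2|)
       + (`|nu| - 1)^-1 * (`|V1| + h^-1 * `|V2|)).
Proof.
move=> K1 h0 B0 Q1 QaP QbP munu nu1 V1E v0K V2K Q'E yE fB gB j jN.
pose A (Q : 'M[R]_2) := `|Q *m V1| + h^-1 * `|Q *m V2|.
pose F := `|V1| + h^-1 * `|V2|.
have hV0 : 0 < h^-1 by rewrite invr_gt0.
have A0 Q : 0 <= A Q by rewrite addr_ge0// mulr_ge0// ltW.
have Qb1 : Qb = 1%:M - Qa by rewrite -Q1 [Qa + Qb]addrC addrK.
have QfB Q i : (i < N)%N -> `|Q *m (f i *: V1 + g i *: V2)| <= B * A Q.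
  move=> iN; rewrite mulmxDr -!scalemxAr (le_trans (ler_normD _ _))// !normrZ /A mulrDr.
  by rewrite lerD ?ler_wpM2r ?fB// mulrA ler_wpM2r// gB.
have nu0 : `|nu| != 0 by rewrite gt_eqF// (lt_trans ltr01).
have mu1 : `|mu| = `|nu|^-1.
  by apply: (mulIf nu0); rewrite mulVf// -normrM munu normr1.
have AF : A Qb <= F + A Qa.
  rewrite /A /F Qb1 !mulmxBl !mul1mx.
  have := ler_normB V1 (Qa *m V1).
  have : h^-1 * `|V2 - Qa *m V2| <= h^-1 * (`|V2| + `|Qa *m V2|).
    by rewrite ler_wpM2l ?ler_normB// ltW.
  rewrite mulrDr; lra.
have za : `|Qa *m y j| <= B * A Qa / (1 - `|mu|).
  apply: (cyclic_contraction N mu _ (fun i => Qa *m y i)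
    (fun i => Qa *m (f i *: V1 + g i *: V2))) => //.
  - by rewrite mu1 invf_lt1// (lt_trans ltr01).
  - by move=> i iN; rewrite (yE i iN) mulmxDr mulmxA QaP -scalemxAl.
  - by move=> i iN; exact: QfB.
have zb : `|Qb *m y j| <= B * A Qb / (`|nu| - 1).
  apply: (cyclic_expansion N nu _ (fun i => Qb *m y i)
    (fun i => Qb *m (f i *: V1 + g i *: V2))) => //.
  - by move=> i iN; rewrite (yE i iN) mulmxDr mulmxA QbP -scalemxAl.
  - by move=> i iN; exact: QfB.
(* If [Q'] is [Qb], replacing A(Qa) by A(Qb) costs K for [V1], by [spectral_swap] and |v0| <= K, and
   1 for [V2], as 1 / (2 K) <= 1. *)
have AQ' : A Qa <= A Q' + (K + 1).
  case: Q'E => ->; first by rewrite lerDl; lra.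
  have s1 := spectral_swap Qa Qb P mu nu v0 Q1 QaP QbP munu (ltW nu1).
  have s2 : `|Qa *m V2| <= `|V2| + `|Qb *m V2|.
    have -> : Qa *m V2 = V2 - Qb *m V2 by rewrite -[V2 in V2 - _]mul1mx -Q1 mulmxDl addrK.
    exact: ler_normB.
  rewrite /A V1E.
  have : h^-1 * `|Qa *m V2| <= h^-1 * (`|V2| + `|Qb *m V2|).
    by rewrite ler_wpM2l// ltW.
  rewrite mulrDr V2K.
  have : (2 * K)^-1 <= 1 by rewrite invf_le1; lra.
  lra.
have F2 : (2 * K)^-1 <= F by rewrite /F V2K lerDr.
set w := (`|nu| - 1)^-1.
have w0 : 0 < w by rewrite invr_gt0 subr_gt0.
have wE : (`|nu| + 1) / (`|nu| - 1) = 1 + 2 * w.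
  by rewrite /w; field; rewrite subr_eq0 gt_eqF.
have w1 : (1 - `|mu|)^-1 = 1 + w.
  by rewrite mu1 /w; field; rewrite nu0 subr_eq0 gt_eqF.
have -> : y j = Qa *m y j + Qb *m y j by rewrite -mulmxDl Q1 mul1mx.
rewrite (le_trans (ler_normD _ _))// (le_trans (lerD za zb))// w1 -/w wE -/(A Q') -/F.
apply: (@le_trans _ _ (B * ((A Q' + (K + 1)) * (1 + 2 * w) + F * w))).
  rewrite -!mulrA -mulrDr ler_wpM2l//.
  have : A Qa * (1 + 2 * w) <= (A Q' + (K + 1)) * (1 + 2 * w).
    by rewrite ler_wpM2r//; lra.
  have : A Qb * w <= (F + A Qa) * w by rewrite ler_wpM2r// ltW.
  lra.
rewrite [leRHS](_ : _ = B * (9 * K ^+ 2 * (1 + (1 + 2 * w) * A Q' + w * F))); last by ring.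
rewrite ler_wpM2l//.
have AQ0 := A0 Q'.
have KK : K <= K ^+ 2 by rewrite expr2 ler_peMl//; lra.
have F0 : 0 < F by rewrite (lt_le_trans _ F2)// invr_gt0; lra.
have FK : 1 <= F * (2 * K).
  by rewrite -ler_pdivrMr ?mul1r//; lra.
(* The cost of the exchange is charged to F: 2 (K + 1) w <= 4 K w <= 4 K w (2 K F). Together with
   the K^2 w F of [T2] this makes 9 K^2. *)
have KF : 2 * (K + 1) * w <= 8 * K ^+ 2 * (w * F).
  apply: (@le_trans _ _ (4 * K * w * (F * (2 * K)))); last by lra.
  apply: (@le_trans _ _ (4 * K * w)); last by rewrite ler_peMr// !mulr_ge0//; lra.
  by rewrite ler_wpM2r//; lra.
have T1 : (1 + 2 * w) * A Q' <= 9 * K ^+ 2 * ((1 + 2 * w) * A Q').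
  by rewrite ler_peMl//; [rewrite mulr_ge0//; lra|lra].
have T2 : w * F <= K ^+ 2 * (w * F).
  by rewrite ler_peMl//; [rewrite mulr_ge0//; lra|lra].
lra.
Qed.

End cyclic_bound.

(** * Local approximation and interface conditions *)

Section taylor.
Context {R : realType}.
Local Notation mu := (@lebesgue_measure R).
Implicit Types (U : nat -> R -> R).

Lemma is_derive_continuous (f : R -> R) (df x : R) :
  is_derive x 1 f df -> {for x, continuous f}.
Proof.
move=> dfx; apply: differentiable_continuous; apply/derivable1_diffP.
exact: ex_derive.
Qed.

(** Induction on n: the polynomial for [U 1] is integrated, and the mean value theorem turns its
    error bound into one for [U 0] with one more factor x - x0. No factorials are gained, so [M]
    stays the same. *)
Lemma taylor_polynomial n U (x0 x1 M : R) : x0 <= x1 -> 0 <= M ->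
  (forall i x, (i < n)%N -> x0 <= x <= x1 -> is_derive x 1 (U i) (U i.+1 x)) ->
  (forall x, x0 <= x <= x1 -> `|U n x - U n x0| <= M * (x - x0)) ->
  exists T : {poly R}, [/\ (size T <= n.+1)%N, T.[x0] = U 0 x0,
    forall x, x0 <= x <= x1 -> `|U 0 x - T.[x]| <= M * (x - x0) ^+ n.+1
  & (0 < n)%N -> T^`().[x0] = U 1 x0 /\
    forall x, x0 <= x <= x1 -> `|U 1 x - T^`().[x]| <= M * (x - x0) ^+ n].
Proof.
move=> x01 M0; elim: n U => [|n IHn] U dU UM.
  exists (U 0 x0)%:P; split=> //; first exact: size_polyC_leq1.
    by rewrite hornerC.
  by move=> x xx; rewrite hornerC expr1 UM.
have [|//|T1 [sT1 T1x0 T1E _]] := IHn (fun i => U i.+1); first by move=> i x lin; exact: dU.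
pose T := antiderivp T1 + (U 0 x0 - (antiderivp T1).[x0])%:P.
have T'E : T^`() = T1 by rewrite derivD derivC addr0 deriv_antiderivp.
have Tx0 : T.[x0] = U 0 x0 by rewrite hornerD hornerC subrKC.
exists T; split => //.
- rewrite (leq_trans (size_polyD _ _))// geq_max.
  rewrite (leq_trans (size_poly _ _))//= (leq_trans (size_polyC_leq1 _))//.
- move=> x /andP[]; rewrite le_eqVlt => /predU1P[<- _|x0x xx1].
    by rewrite Tx0 !subrr normr0 mulr_ge0// exprn_ge0.
  have dUT y : x0 <= y <= x1 -> is_derive y 1 (fun y => U 0 y - T.[y]) (U 1 y - T1.[y]).
    move=> yx; have dU0 := dU 0 y isT yx.
    by rewrite -T'E; apply: is_deriveB; exact: is_derive_horner.
  have dd y : y \in `]x0, x[ -> is_derive y 1 (fun y => U 0 y - T.[y]) (U 1 y - T1.[y]).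
    by rewrite in_itv/= => /andP[? ?]; apply: dUT; apply/andP; split; lra.
  have cUT : {within `[x0, x], continuous (fun y => U 0 y - T.[y])}.
    apply: continuous_in_subspaceT => y; rewrite inE/= in_itv/= => /andP[? ?].
    by apply: (is_derive_continuous _ (U 1 y - T1.[y])); apply: dUT; apply/andP; split; lra.
  have [y] := MVT x0x dd cUT; rewrite in_itv/= => /andP[x0y yx].
  rewrite Tx0 subrr subr0 => ->.
  have xx0 : 0 < x - x0 by rewrite subr_gt0.
  rewrite normrM (gtr0_norm xx0) exprSr mulrA ler_wpM2r ?(ltW xx0)//.
  have yI : x0 <= y <= x1 by apply/andP; split; lra.
  rewrite (le_trans (T1E y yI))// ler_wpM2l// lerXn2r// ?nnegrE; lra.
- by move=> _; rewrite T'E; split=> // x xx; exact: T1E.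
Qed.

End taylor.

Section cell.
Context {R : realType}.
Local Notation mu := (@lebesgue_measure R).
Implicit Types (f : R -> R) (p q : {poly R}) (x y B h : R).

Lemma Rintegral_itvoo f x y : continuous f ->
  \int[mu]_(t in `]x, y[) f t = \int[mu]_(t in `[x, y]) f t.
Proof.
move=> cf; have If := continuous_integrable_itv x y f cf.
rewrite Rintegral_itv_bndo_bndc; last first.
  by apply: integrableS If => //; exact: subset_itv_oo_cc.
rewrite Rintegral_itv_obnd_cbnd//.
by apply: integrableS If => //; exact: subset_itv_oc_cc.
Qed.

Lemma norm_Rintegral_le f x y B : x <= y -> continuous f ->
  (forall t, x <= t <= y -> `|f t| <= B) ->
  `|\int[mu]_(t in `[x, y]) f t| <= B * (y - x).
Proof.
move=> xy cf fB; have If := continuous_integrable_itv x y f cf.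
rewrite (le_trans (le_normr_Rintegral _ If))//.
apply: (@le_trans _ _ (\int[mu]_(t in `[x, y]) B)).
  apply: le_Rintegral => //.
  - exact: (integrable_norm If).
  - by apply: continuous_integrable_itv => t; exact: cvg_cst.
have [xy'|] := ltP x y; last first.
  move=> yx; have -> : y = x by apply/eqP; rewrite eq_le yx.
  by rewrite set_itv1 Rintegral_set1 subrr mulr0.
by rewrite Rintegral_cst//= lebesgue_measure_itv/= lte_fin xy'.
Qed.

Definition rescale x h : {poly R} := h *: 'X + x%:P.

Lemma horner_rescale p x h t : (p \Po rescale x h).[t] = p.[h * t + x].
Proof. by rewrite horner_comp !hornerE. Qed.

Lemma deriv_rescale p x h : (p \Po rescale x h)^`() = h *: (p^`() \Po rescale x h).
Proof.
rewrite deriv_comp derivD derivZ derivX derivC addr0.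
by rewrite -scalerAr mulr1.
Qed.

Lemma size_rescale p x h : (size (p \Po rescale x h) <= size p)%N.
Proof.
have [->|p0] := eqVneq p 0; first by rewrite comp_poly0 size_poly0.
rewrite (leq_trans (size_comp_poly_leq _ _))//.
have s2 : (size (rescale x h) <= 2)%N.
  rewrite (leq_trans (size_polyD _ _))// geq_max (leq_trans (size_polyC_leq1 _))// andbT.
  by rewrite (leq_trans (size_scale_leq _ _))// size_polyX.
rewrite -[leqRHS]prednK ?size_poly_gt0// ltnS.
by rewrite -[leqRHS]muln1 leq_mul2l -[(size (rescale _ _)).-1]subn1 leq_subLR s2 orbT.
Qed.

Lemma Rintegral_rescale p x h : 0 < h ->
  \int[mu]_(t in `[x, x + h]) p.[t] = h * integral01 (p \Po rescale x h).
Proof.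
move=> h0; rewrite Rintegral_horner ?lerDl ?(ltW h0)// -integral01Z.
have -> : h *: (p \Po rescale x h) = (antiderivp p \Po rescale x h)^`().
  by rewrite deriv_rescale deriv_antiderivp.
by rewrite integral01_deriv !horner_rescale mulr1 mulr0 add0r (addrC h x).
Qed.

Lemma poly_bound01 p : exists2 B, 0 <= B & forall t, `|t| <= 1 -> `|p.[t]| <= B.
Proof.
pose B := \sum_(i < size p) `|p`_i|.
exists ((size p)%:R * B) => [|t t1]; first by rewrite mulr_ge0// sumr_ge0.
apply: horner_norm_bound => // i.
have [ip|pi] := ltnP i (size p); last by rewrite nth_default// normr0 sumr_ge0.
by rewrite /B (bigD1 (Ordinal ip))//= lerDl sumr_ge0.
Qed.

(** Degrees are shifted: [q] has degree at most k + 1. On the reference cell, the lift Z takes over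
    the moments and the right-end value of u - T, so that q - T - Z is orthogonal to degrees below k
    and [legendre_decomp] applies. [du0] and [du1] stand for the derivatives of u at the two
    ends. *)
Lemma cell_decomposition k : exists2 C : R, 0 <= C &
  forall (x h B du0 du1 : R) (u : R -> R) (T q : {poly R}),
    0 < h -> continuous u ->
    (size T <= k.+2)%N -> T.[x] = u x -> T^`().[x] = du0 ->
    (forall t, x <= t <= x + h -> `|u t - T.[t]| <= B) ->
    `|du1 - T^`().[x + h]| <= B / h ->
    (size q <= k.+2)%N ->
    (forall v : {poly R}, (size v <= k)%N ->
      \int[mu]_(t in `]x, x + h[) (q.[t] * v.[t]) =
      \int[mu]_(t in `]x, x + h[) (u t * v.[t])) ->
  exists y1 y2 z z' : R,
  [/\ `|z| <= C * B /\ `|z'| <= C * (B / h),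
      q.[x + h] = y1 + y2 + u (x + h)
      /\ q^`().[x + h] =
         ((k * k.+1)%:R * y1 + (k.+1 * k.+2)%:R * y2) / h + du1 + z',
      q.[x] = (-1) ^+ k * (y1 - y2) + u x + z
      /\ q^`().[x] =
         (-1) ^+ k * (- (k * k.+1)%:R * y1 + (k.+1 * k.+2)%:R * y2) / h + du0
    & forall t, x <= t <= x + h ->
        `|q.[t] - u t| <= C * (`|y1| + `|y2| + B)].
Proof.
have [K K0 lift] := @local_lift R k.
have [B1 B10 P1B] := poly_bound01 (legendre k).
have [B2 B20 P2B] := poly_bound01 (legendre k.+1).
exists (K + 1 + B1 + B2); first by rewrite !addr_ge0.
move=> x h B du0 du1 u T q h0 cu sT Tx T'x uTB duTB sq qu.
have hn0 : h != 0 by rewrite gt_eqF.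
have B0 : 0 <= B by rewrite (le_trans _ (uTB x _))// lexx/= lerDl ltW.
have xxh : x <= x + h by rewrite lerDl ltW.
(* These become the monomials on [0, 1] and are bounded by 1 on the cell. *)
pose mono i : {poly R} := (h^-1 *: ('X - x%:P)) ^+ i.
have mono_rescale i : mono i \Po rescale x h = 'X^i.
  rewrite rmorphXn/=; congr (_ ^+ i).
  rewrite comp_polyZ comp_polyB comp_polyX comp_polyC /rescale addrK scalerA.
  by rewrite mulVf// scale1r.
pose m i : R := h^-1 * \int[mu]_(t in `[x, x + h]) ((u t - T.[t]) * (mono i).[t]).
have cuT : continuous (fun t => u t - T.[t]).
  by move=> t; apply: cvgB; [exact: cu|exact: continuous_horner].
have mB i : (i < k)%N -> `|m i| <= B.
  move=> ik; rewrite /m normrM gtr0_norm ?invr_gt0// mulrC ler_pdivrMr//.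
  rewrite [X in _ <= _ * X](_ : h = x + h - x); last by rewrite addrAC subrr add0r.
  apply: norm_Rintegral_le => //.
    by move=> t; apply: cvgM; [exact: cuT|exact: continuous_horner].
  move=> t xt; rewrite normrM -[B]mulr1 ler_pM ?uTB// horner_exp normrX exprn_ile1//.
  have /andP[xt1 xt2] := xt.
  rewrite !hornerE normrM gtr0_norm ?invr_gt0// mulrC ler_pdivrMr// mul1r ger0_norm; lra.
have vB : `|u (x + h) - T.[x + h]| <= B by apply: uTB; rewrite lexx andbT.
have [Z [sZ Zm [Z1 Z'0] ZB Z'1]] := lift m _ _ vB mB.
pose e := (q - T) \Po rescale x h - Z.
have se : (size e <= k.+2)%N.
  rewrite (leq_trans (size_polyD _ _))// geq_max size_polyN sZ andbT.
  rewrite (leq_trans (size_rescale _ _ _))// (leq_trans (size_polyD _ _))//.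
  by rewrite geq_max size_polyN sq.
have eorth i : (i < k)%N -> integral01 (e * 'X^i) = 0.
  move=> ik.
  have -> : e * 'X^i = ((q - T) \Po rescale x h) * 'X^i + (-1) *: (Z * 'X^i).
    by rewrite /e mulrBl scaleN1r.
  rewrite integral01D integral01Z Zm//.
  rewrite -(mono_rescale i) -rmorphM/=; apply: (mulfI hn0).
  rewrite mulr0 mulrDr -Rintegral_rescale// /m mulN1r mulrN mulVKf//.
  have smono : (size (mono i) <= k)%N.
    rewrite /mono exprZn (leq_trans (size_scale_leq _ _))// size_exp_XsubC//.
  have cqm : continuous (fun t => q.[t] * (mono i).[t]).
    by move=> t; apply: cvgM; exact: continuous_horner.
  have cTm : continuous (fun t => T.[t] * (mono i).[t]).
    by move=> t; apply: cvgM; exact: continuous_horner.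
  have cum : continuous (fun t => u t * (mono i).[t]).
    by move=> t; apply: cvgM; [exact: cu|exact: continuous_horner].
  have := qu (mono i) smono; rewrite !Rintegral_itvoo// => quE.
  under eq_Rintegral do rewrite hornerM hornerD hornerN mulrBl.
  under [X in _ - X]eq_Rintegral do rewrite mulrBl.
  rewrite !RintegralB// ?quE ?subrr//.
  1-4: by apply: continuous_integrable_itv.
have [v sv|y1 [y2 eE]] := legendre_decomp k e se.
  rewrite (poly_sum_wide k v sv) big_distrr /= integral01_sum big1// => i _.
  by rewrite -(scalerAr v`_i e) integral01Z eorth ?mulr0.
have qE t : q.[h * t + x] = y1 * (legendre k).[t] + y2 * (legendre k.+1).[t]
    + Z.[t] + T.[h * t + x].
  rewrite -horner_lin2 -eE /e hornerD hornerN horner_rescale hornerD hornerN.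
  by ring.
have q'E t : q^`().[h * t + x] =
    (y1 * (legendre k)^`().[t] + y2 * (legendre k.+1)^`().[t] + Z^`().[t]) / h
    + T^`().[h * t + x].
  rewrite -horner_lin2 -deriv_lin2 -eE /e derivB hornerD hornerN deriv_rescale.
  rewrite hornerZ horner_rescale derivB hornerD hornerN.
  by field.
have h1 : h * 1 + x = x + h by rewrite mulr1 addrC.
have h00 : h * 0 + x = x by rewrite mulr0 add0r.
(* The defects are what the lift leaves unmatched: its value at the left end, and its scaled slope
   at the right end minus the error of T' there. *)
exists y1, y2, Z.[0], (Z^`().[1] / h - (du1 - T^`().[x + h])); split.
- split.
    rewrite (le_trans (ZB 0 _)) ?normr0// ler_wpM2r//; lra.
  rewrite (le_trans (ler_normB _ _))//.
  apply: (@le_trans _ _ (K * (B / h) + B / h)).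
    rewrite lerD// normrM [X in _ * X]gtr0_norm ?invr_gt0// mulrA.
    by rewrite ler_wpM2r// invr_ge0 ltW.
  rewrite -[X in _ + X]mul1r -mulrDl ler_wpM2r//; last lra.
  by rewrite divr_ge0// ltW.
- by rewrite -h1 qE q'E !legendre1 !deriv_legendre1 Z1 h1; split; field.
- have := qE 0; have := q'E 0; rewrite h00 !legendre0 !deriv_legendre0 Z'0 Tx T'x exprS.
  by move=> -> ->; split; field.
- move=> t /andP[xt txh]; pose s := (t - x) / h.
  have tE : t = h * s + x by rewrite /s; field.
  have s1 : `|s| <= 1.
    rewrite ger0_norm ?divr_ge0 ?subr_ge0 ?(ltW h0)// ler_pdivrMr// mul1r; lra.
  have -> : q.[t] - u t = y1 * (legendre k).[s] + y2 * (legendre k.+1).[s]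
      + Z.[s] - (u t - T.[t]).
    by rewrite {1}tE qE -tE; ring.
  have N1 : `|y1 * (legendre k).[s]| <= `|y1| * B1 by rewrite normrM ler_wpM2l// P1B.
  have N2 : `|y2 * (legendre k.+1).[s]| <= `|y2| * B2 by rewrite normrM ler_wpM2l// P2B.
  have N3 := ZB s s1.
  have N4 : `|u t - T.[t]| <= B by apply: uTB; rewrite xt.
  rewrite (le_trans (ler_normB _ _))//.
  apply: (@le_trans _ _ (`|y1| * B1 + `|y2| * B2 + K * B + B)).
    rewrite lerD// (le_trans (ler_normD _ _))// lerD// (le_trans (ler_normD _ _))//.
    by rewrite lerD.
  have Y1 := normr_ge0 y1; have Y2 := normr_ge0 y2.
  have : 0 <= `|y1| * (K + 1 + B2) by rewrite mulr_ge0//; lra.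
  have : 0 <= `|y2| * (K + 1 + B1) by rewrite mulr_ge0//; lra.
  have : 0 <= B * (B1 + B2) by rewrite mulr_ge0//; lra.
  lra.
Qed.

End cell.

(** * From pointwise bounds to L^p norms *)

Section Lp_bounds.
Context {R : realType}.
Local Notation mu := (@lebesgue_measure R).
Implicit Types (a b x E M : R) (f g : R -> R).

(** The L^oo norm is an essential supremum only on a space of positive measure; this selects that
    case. *)
Lemma lebesgue_measureT_gt0 : (0 < mu setT)%E.
Proof.
apply: (@lt_le_trans _ _ (mu `[0, 1])).
  by rewrite lebesgue_measure_itv/= lte_fin ltr01 oppr0 adde0 lte_fin.
by apply: le_measure; rewrite ?inE.
Qed.

Lemma Lp_norm_oo_ae a b f M : (Lp_norm a b +oo f <= M%:E)%E ->
  {ae mu, forall x, x \in `[a, b] -> `|f x| <= M}.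
Proof.
rewrite /Lp_norm unlock lebesgue_measureT_gt0 => /ess_supP fM.
have [N [mN N0 fN]] := fM; exists N; split => // x /= fx; apply: fN => /= h.
apply: fx => xab; move: h; rewrite patchE mem_setE xab /= lee_fin.
exact.
Qed.

(** The constant 1 + (b - a) dominates both 1, for p = oo, and the square root of b - a, for p =
    2. *)
Lemma Lp_norm_le a b f E p : a <= b -> p = 2%:E \/ p = +oo%E -> 0 <= E ->
  measurable_fun (`[a, b] : set (measurableTypeR R)) f ->
  {ae mu, forall x, x \in `[a, b] -> `|f x| <= E} ->
  (Lp_norm a b p f <= ((1 + (b - a)) * E)%:E)%E.
Proof.
move=> ab pE E0 mf fE.
have ba1 : 1 <= 1 + (b - a) by rewrite lerDl subr_ge0.
case: pE => ->; rewrite /Lp_norm unlock; last first.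
  rewrite lebesgue_measureT_gt0; apply/ess_supP.
  have [N [mN N0 fN]] := fE; exists N; split => // x /= fx; apply: fN => /= h.
  apply: fx; rewrite patchE mem_setE; case: ifP => [/h fxE|_].
    by rewrite /= lee_fin (le_trans fxE)// ler_peMl.
  by rewrite /= normr0 lee_fin mulr_ge0// (le_trans ler01).
have mfab : measurable_fun setT ((EFin \o f) \_ `[a, b]).
  apply/(measurable_restrictT _ _).1 => //; exact/measurable_EFinP.
have mpow : measurable_fun setT (fun x => (`|((EFin \o f) \_ `[a, b]) x| `^ 2)%E).
  apply: (@measurableT_comp _ _ _ _ _ _ (fun y => y `^ 2)%E) => //=.
    exact: (measurableT_comp (measurable_poweR _)).
  exact: measurableT_comp.
have Ile : (\int[mu]_x (`|((EFin \o f) \_ `[a, b]) x| `^ 2) <= (E ^+ 2 * (b - a))%:E)%E.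
  apply: (@le_trans _ _ (\int[mu]_(x in `[a, b]) (E ^+ 2)%:E)%E).
    rewrite [leRHS]integral_mkcond; apply: ae_ge0_le_integral => //.
    - by move=> x _; exact: poweR_ge0.
    - by move=> x _; rewrite patchE; case: ifP => // _; rewrite lee_fin sqr_ge0.
    - by apply/(measurable_restrictT _ _).1.
    - have [M [mM M0 fM]] := fE; exists M; split => // x /= fx; apply: fM => /= h.
      apply: fx => _; rewrite !patchE mem_setE; case: ifP => [/h fxE|_].
        rewrite /= lee_fin -powR_mulrn ?normr_ge0// ge0_ler_powR//.
      by rewrite /= normr0 powR0.
  rewrite integral_cst//= lebesgue_measure_itv/= lte_fin; case: ifP => _.
    by rewrite -EFinD -EFinM.
  by rewrite mule0 lee_fin mulr_ge0 ?sqr_ge0// subr_ge0.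
apply: (@le_trans _ _ ((E ^+ 2 * (b - a))%:E `^ 2^-1)%E).
  apply: gt0_ler_poweR => //; rewrite ?in_itv/= ?leey ?andbT.
  - by apply: integral_ge0 => x _; exact: poweR_ge0.
  - by rewrite lee_fin mulr_ge0 ?sqr_ge0// subr_ge0.
rewrite poweR_EFin lee_fin powR12_sqrt ?mulr_ge0 ?sqr_ge0 ?subr_ge0//.
rewrite sqrtrM ?sqr_ge0// sqrtr_sqr ger0_norm// mulrC ler_wpM2r//.
rewrite -[leRHS]ger0_norm ?(le_trans ler01)// -sqrtr_sqr ler_wsqrtr//.
have ba0 : 0 <= b - a by rewrite subr_ge0.
by have := sqr_ge0 (b - a); rewrite sqrrD; lra.
Qed.

(** The interval is exhausted cell by cell; the nodes, where w is arbitrary, are added as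
    singletons. *)
Lemma dg_space_measurable a b (N k : nat) (w : R -> R) : (0 < N)%N -> a < b ->
  dg_space a b N k w -> measurable_fun (`[a, b] : set (measurableTypeR R)) w.
Proof.
move=> N0 ab wdg.
have h0 : 0 < mesh_size a b N by rewrite divr_gt0 ?subr_gt0// ltr0n.
have node0 : node a b N 0 = a by rewrite /node mul0r addr0.
have nodeS j : node a b N j.+1 = node a b N j + mesh_size a b N.
  by rewrite /node -natr1 mulrDl mul1r addrA.
have nodeN : node a b N N = b.
  by rewrite /node /mesh_size mulrC divfK ?pnatr_eq0 -?lt0n// subrKC.
have H j : (j <= N)%N ->
    measurable_fun (`[a, node a b N j] : set (measurableTypeR R)) w.
  elim: j => [|j IHj] jN; first by rewrite node0 set_itv1; exact: measurable_fun_set1.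
  have nj : a <= node a b N j by rewrite /node lerDl mulr_ge0// ltW.
  rewrite (_ : `[a, node a b N j.+1]%classic =
      (`[a, node a b N j] `|` cell a b N j) `|` [set node a b N j.+1]); last first.
    apply/seteqP; split=> x; rewrite /cell /= !in_itv/= nodeS.
      move=> /andP[ax]; rewrite le_eqVlt => /predU1P[->|xj]; first by right.
      left; have [xn|nx] := leP x (node a b N j); [left|right]; apply/andP; split => //.
    by move=> [[/andP[ax xn]|/andP[nx xn]]| ->]; apply/andP; split; lra.
  have mcell : measurable (cell a b N j : set (measurableTypeR R)).
    exact: measurable_itv.
  apply/measurable_funU => //; first exact: measurableU.
  split; last exact: measurable_fun_set1.
  apply/measurable_funU => //; split; first exact: IHj (ltnW jN).
  have [q _ wq] := wdg j jN.
  apply: (eq_measurable_fun (horner q)); first by move=> x; rewrite inE => /wq ->.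
  by apply: measurable_funTS; apply: continuous_measurable_fun; exact: continuous_horner.
by have := H N (leqnn N); rewrite nodeN.
Qed.

End Lp_bounds.

Section sobolev_taylor.
Context {R : realType}.
Local Notation mu := (@lebesgue_measure R).
Implicit Types (u w : R -> R).

Lemma derive1_periodic u (T x : R) :
  (forall x, u (x + T) = u x) -> derive1 u (x + T) = derive1 u x.
Proof.
by move=> uT; rewrite /derive1; under eq_fun do rewrite addrA !uT.
Qed.

Lemma sobolev_taylor_polynomial k u (a b M : R) : (0 < k)%N -> a < b -> 0 <= M ->
  periodic_sobolev_oo k.+1 a b u ->
  (sobolev_oo_seminorm k.+1 a b u <= M%:E)%E ->
  forall x0 h : R, a <= x0 -> 0 < h -> x0 + h <= b ->
  exists T : {poly R}, [/\ (size T <= k.+1)%N, T.[x0] = u x0,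
    T^`().[x0] = derive1 u x0,
    forall x, x0 <= x <= x0 + h -> `|u x - T.[x]| <= M * h ^+ k.+1
  & `|derive1 u (x0 + h) - T^`().[x0 + h]| <= M * h ^+ k.+1 / h].
Proof.
move=> k0 ab M0 [uper cu wu] uM x0 h ax0 h0 x0hb.
have [g0 wg0 _] := wu k.+1 (leqnn _).
have wg : is_weak_derivative k.+1 u (weak_derivative k.+1 u).
  by have := @getPex _ [set g | is_weak_derivative k.+1 u g] (ex_intro _ g0 wg0).
set g := weak_derivative k.+1 u in wg.
have gM := Lp_norm_oo_ae a b g M uM.
(* On this larger interval [a] and [b] are interior, so that u has two-sided derivatives there; the
   bound on [g] is used on [a, b] only. *)
have cd : a - 1 < b + 1 by lra.
have [U [U0 dU Uk]] := weak_derivative_chain k u g (a - 1) (b + 1) cd cu wg.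
have [_ Lg _] := wg.
have hn0 : h != 0 by rewrite gt_eqF.
have inI x : x0 <= x <= x0 + h -> a - 1 < x < b + 1.
  by move=> /andP[? ?]; apply/andP; split; lra.
have du x : x0 <= x <= x0 + h -> derive1 u x = U 1 x.
  move=> /inI xI; have dU0 := dU 0 x k0 xI; have /andP[xa xb] := xI.
  have dux : is_derive x 1 u (U 1 x).
    apply: near_eq_is_derive dU0; near=> t; apply: U0; apply/andP; split.
      by near: t; exact: lt_nbhsr.
    by near: t; exact: lt_nbhsl.
  by rewrite derive1E derive_val.
have [|//|x /andP[x0x xx1]|T [sT Tx0 TB /(_ k0)[T'x0 T'B]]] :=
    taylor_polynomial k U x0 (x0 + h) M _ M0.
- by rewrite lerDl ltW.
- by move=> i x ik /inI; exact: dU.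
- rewrite Uk; [|lra|exact: x0x|lra].
  apply: norm_Rintegral_le_ae => //.
  + have := locally_integrable_fromT x0 g Lg x.
    by apply: integrableS => //; exact: subset_itv_oc_cc.
  + have [S [mS S0 gS]] := gM; exists S; split => // t /= gt; apply: gS => /= H.
    apply: gt; rewrite in_itv/= => /andP[? ?]; apply: H.
    by rewrite in_itv/=; apply/andP; split; lra.
have x0I : x0 <= x0 <= x0 + h by rewrite lexx lerDl ltW.
have x1I : x0 <= x0 + h <= x0 + h by rewrite lexx lerDl ltW.
exists T; split => //.
- by rewrite Tx0 U0// inI.
- by rewrite T'x0 du.
- move=> x xI; have /andP[x0x xx1] := xI.
  rewrite -U0 ?inI// (le_trans (TB x xI))// ler_wpM2l// lerXn2r// ?nnegrE; lra.
- rewrite du// (le_trans (T'B _ x1I))// addrAC subrr add0r exprSr mulrA mulfK//.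
Unshelve. all: by end_near. Qed.

End sobolev_taylor.

(** * One-sided traces at the nodes and the null set of nodes *)

Section mesh.
Context {R : realType}.
Local Notation mu := (@lebesgue_measure R).
Implicit Types (f g w : R -> R).

Lemma lim_at_left_eq f g (x y : R) : x < y ->
  (forall t, x < t < y -> f t = g t) -> {for y, continuous g} ->
  lim (f t @[t --> y^'-]) = g y.
Proof.
move=> xy fg cg; apply/cvg_lim => //.
apply: (@cvg_trans _ (g t @[t --> y^'-])); last exact: cvg_at_left_filter.
apply: near_eq_cvg; near=> t; rewrite fg//; apply/andP; split.
  by near: t; exact: nbhs_left_gt.
by near: t; exact: nbhs_left_lt.
Unshelve. all: by end_near. Qed.

Lemma lim_at_right_eq f g (x y : R) : x < y ->
  (forall t, x < t < y -> f t = g t) -> {for x, continuous g} ->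
  lim (f t @[t --> x^'+]) = g x.
Proof.
move=> xy fg cg; apply/cvg_lim => //.
apply: (@cvg_trans _ (g t @[t --> x^'+])); last exact: cvg_at_right_filter.
apply: near_eq_cvg; near=> t; rewrite fg//; apply/andP; split.
  by near: t; exact: nbhs_right_gt.
by near: t; exact: nbhs_right_lt.
Unshelve. all: by end_near. Qed.

Lemma derive1_eq_horner w (q : {poly R}) (x y : R) :
  (forall t, x < t < y -> w t = q.[t]) ->
  forall t, x < t < y -> derive1 w t = q^`().[t].
Proof.
move=> wq t /andP[xt ty]; rewrite derivE !derive1E.
apply: near_eq_derive; near=> s; apply: wq; apply/andP; split.
  by near: s; exact: lt_nbhsr.
by near: s; exact: lt_nbhsl.
Unshelve. all: by end_near. Qed.

Variables (a b : R) (N : nat).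
Hypotheses (ab : a < b) (N0 : (0 < N)%N).

Lemma mesh_size_gt0 : 0 < mesh_size a b N.
Proof. by rewrite divr_gt0 ?subr_gt0// ltr0n. Qed.

Lemma node0 : node a b N 0 = a.
Proof. by rewrite /node mul0r addr0. Qed.

Lemma nodeS j : node a b N j.+1 = node a b N j + mesh_size a b N.
Proof. by rewrite /node -natr1 mulrDl mul1r addrA. Qed.

Lemma nodeN : node a b N N = b.
Proof. by rewrite /node /mesh_size mulrC divfK ?pnatr_eq0 -?lt0n// subrKC. Qed.

Lemma node_ge j : a <= node a b N j.
Proof. by rewrite /node lerDl mulr_ge0// ltW// mesh_size_gt0. Qed.

Lemma node_le j : (j <= N)%N -> node a b N j <= b.
Proof.
move=> jN; rewrite -[leRHS]nodeN /node lerD2l ler_wpM2r ?ler_nat//.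
exact/ltW/mesh_size_gt0.
Qed.

Lemma trace_minus_cell w (q : {poly R}) j :
  (forall x, cell a b N j x -> w x = q.[x]) ->
  trace_minus a b N w j.+1 = q.[node a b N j.+1].
Proof.
move=> wq; apply: (lim_at_left_eq _ (horner q) (node a b N j)).
- by rewrite nodeS ltrDl mesh_size_gt0.
- by move=> t tI; apply: wq; rewrite /cell /= in_itv.
- exact: continuous_horner.
Qed.

Lemma trace_plus_cell w (q : {poly R}) j :
  (forall x, cell a b N (j %% N) x -> w x = q.[x]) ->
  trace_plus a b N w j = q.[node a b N (j %% N)].
Proof.
move=> wq; apply: (lim_at_right_eq _ (horner q) _ (node a b N (j %% N).+1)).
- by rewrite nodeS ltrDl mesh_size_gt0.
- by move=> t tI; apply: wq; rewrite /cell /= in_itv.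
- exact: continuous_horner.
Qed.

Lemma derive1_cell w (q : {poly R}) j :
  (forall x, cell a b N j x -> w x = q.[x]) ->
  forall x, cell a b N j x -> derive1 w x = q^`().[x].
Proof.
move=> wq x; rewrite /cell /= in_itv/= => xI; apply: derive1_eq_horner xI => t tI.
by apply: wq; rewrite /cell /= in_itv.
Qed.

Lemma ae_cells (P : R -> Prop) :
  (forall j x, (j < N)%N -> cell a b N j x -> P x) ->
  {ae mu, forall x, x \in `[a, b] -> P x}.
Proof.
have ct : countable (range (node a b N)).
  by apply: (sub_countable (card_image_le _ _)); exact: countableP.
move=> cP; exists (range (node a b N)); split.
- exact: countable_measurable ct.
- exact: countable_lebesgue_measure0.
move=> x /= nP; apply: contrapT => xnode; apply: nP => xab.
have H n : (n <= N)%N -> a <= x <= node a b N n -> P x.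
  elim: n => [_|n IHn nN /andP[ax]].
    rewrite node0 => /andP[ax xa]; exfalso; apply: xnode; exists 0 => //.
    by rewrite node0; apply/eqP; rewrite eq_le ax xa.
  rewrite le_eqVlt => /predU1P[xE|xn].
    by exfalso; apply: xnode; exists n.+1.
  have [xn'|] := leP x (node a b N n); first by apply: IHn; [exact: ltnW|rewrite ax].
  by move=> nx; apply: (cP n) => //; rewrite /cell /= in_itv/= nx.
apply: (H N) => //; rewrite nodeN; by move: xab; rewrite in_itv.
Qed.

End mesh.

(** * Pointwise error estimate on each cell *)

Section pointwise_error.
Context {R : realType}.
Local Notation mu := (@lebesgue_measure R).

Lemma Lam_neq0 (k : nat) (h alpha1 beta1 beta2 : R) : (0 < k)%N -> 0 < h ->
  alpha1 ^+ 2 + beta1 * beta2 != 4^-1 -> Lam k h alpha1 beta1 beta2 != 0.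
Proof.
move=> k0 h0 al; rewrite /Lam mulf_neq0 ?subr_eq0// oppr_eq0 gt_eqF//.
by rewrite divr_gt0// mulr_gt0// ltr0n.
Qed.

(** For negative Gam the small eigenvalue is [lambda1], with projection [spectral]; for positive Gam
    the eigenvalues and their projections trade places. By [Q1_spectral], [Q1] in the first case and
    1 - [Q1] in the second is one of the two projections. *)
Lemma factor_bound (k N : nat) (h alpha1 beta1 beta2 B : R)
    (y : nat -> 'cV[R]_2) (f g : nat -> R) :
  (0 < k)%N -> 0 < h -> 0 <= B ->
  Lam k h alpha1 beta1 beta2 != 0 ->
  `|Lam k h alpha1 beta1 beta2| < `|Gam k h alpha1 beta1 beta2| ->
  (forall j, (j < N)%N -> y j = transfer k h alpha1 beta1 beta2 *m y (j.+1 %% N)%N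
     + (f j *: V1 k h alpha1 beta1 beta2 + g j *: V2 k h)) ->
  (forall j, (j < N)%N -> `|f j| <= B) ->
  (forall j, (j < N)%N -> `|g j| <= B / h) ->
  forall j, (j < N)%N ->
  (Gam k h alpha1 beta1 beta2 < 0 ->
     `|y j| <= 9 * k%:R ^+ 2 * B * factor_neg k h alpha1 beta1 beta2) /\
  (0 < Gam k h alpha1 beta1 beta2 ->
     `|y j| <= 9 * k%:R ^+ 2 * B * factor_pos k h alpha1 beta1 beta2).
Proof.
move=> k0 h0 B0 L0 LG yE fB gB j jN.
have K1 : 1 <= k%:R :> R by rewrite ler1n.
have sum1 : spectral k h alpha1 beta1 beta2 + (1%:M - spectral k h alpha1 beta1 beta2)
    = 1%:M by rewrite subrKC.
have s1 := spectral_transfer k h alpha1 beta1 beta2 h0 LG.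
have s2 := onem_spectral_transfer k h alpha1 beta1 beta2 h0 LG.
have V1E := V1_transfer k h alpha1 beta1 beta2 h0.
have V2E := norm_V2 k h k0 h0.
have l12 := lambda12 k h alpha1 beta1 beta2 LG L0.
have v0K : `|- (-1) ^+ k.+1 *: cv2 ((k%:R + 1) / 2) ((k%:R - 1) / 2)| <= k%:R :> R.
  rewrite normrZ normrN normrX normrN1 expr1n mul1r.
  by apply: norm_cv2_le; rewrite ger0_norm; lra.
have Q1E := Q1_spectral k h alpha1 beta1 beta2 h0 LG.
split=> G0.
- apply: (cyclic_projection_bound N k%:R h B (lambda1 k h alpha1 beta1 beta2) _ _ _ _ _ _ _ _ _ f g
    K1 h0 B0 sum1 s1 s2 l12 _ V1E v0K V2E Q1E yE fB gB j jN).
  exact: lambda2_gt1.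
- apply: (cyclic_projection_bound N k%:R h B (lambda2 k h alpha1 beta1 beta2)
    (lambda1 k h alpha1 beta1 beta2) (1%:M - spectral k h alpha1 beta1 beta2)
    (spectral k h alpha1 beta1 beta2) _ _ _ _ _ _ f g
    K1 h0 B0 _ s2 s1 _ _ V1E v0K V2E _ yE fB gB j jN).
  + by rewrite subrK.
  + by rewrite mulrC.
  + exact: lambda1_gt1.
  + by case: Q1E => ->; [left|right; rewrite subKr].
Qed.

(** Lets the factor absorb the local approximation error, which comes without it. *)
Lemma factor_ge1 (k : nat) (h alpha1 beta1 beta2 : R) :
  0 < h -> Lam k h alpha1 beta1 beta2 != 0 ->
  `|Lam k h alpha1 beta1 beta2| < `|Gam k h alpha1 beta1 beta2| ->
  (Gam k h alpha1 beta1 beta2 < 0 -> 1 <= factor_neg k h alpha1 beta1 beta2) /\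
  (0 < Gam k h alpha1 beta1 beta2 -> 1 <= factor_pos k h alpha1 beta1 beta2).
Proof.
move=> h0 L0 LG.
have ge1 (l A F : R) : 1 < `|l| -> 0 <= A -> 0 <= F ->
    1 <= 1 + (`|l| + 1) / (`|l| - 1) * A + (`|l| - 1)^-1 * F.
  move=> l1 A0 F0; rewrite -addrA lerDl addr_ge0// mulr_ge0//.
    by apply: divr_ge0; lra.
  by rewrite invr_ge0; lra.
have nn (v w : 'cV[R]_2) : 0 <= `|v| + h^-1 * `|w|.
  by rewrite addr_ge0// mulr_ge0// invr_ge0 ltW.
split=> G0; apply: ge1 => //.
  exact: lambda2_gt1.
exact: lambda1_gt1.
Qed.

Lemma Phstar_cell_error (k : nat) : (0 < k)%N -> exists2 C : R, 0 <= C &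
  forall (a b : R) (N : nat) (alpha1 beta1 beta2 M : R) (u w : R -> R),
  let h := mesh_size a b N in
  a < b -> (0 < N)%N -> 0 <= M ->
  alpha1 ^+ 2 + beta1 * beta2 != 4^-1 ->
  `|Lam k h alpha1 beta1 beta2| < `|Gam k h alpha1 beta1 beta2| ->
  periodic_sobolev_oo k.+1 a b u ->
  (sobolev_oo_seminorm k.+1 a b u <= M%:E)%E ->
  is_Phstar a b N k alpha1 beta1 beta2 u w ->
  forall j x, (j < N)%N -> cell a b N j x ->
  (Gam k h alpha1 beta1 beta2 < 0 ->
     `|w x - u x| <= C * (M * h ^+ k.+1) * factor_neg k h alpha1 beta1 beta2) /\
  (0 < Gam k h alpha1 beta1 beta2 ->
     `|w x - u x| <= C * (M * h ^+ k.+1) * factor_pos k h alpha1 beta1 beta2).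
Proof.
(* From here on the degree is [k.+1], as in [cell_decomposition]. *)
case: k => // k _.
have [C1 C10 decomp] := @cell_decomposition R k.
(* Each of |y1| and |y2| is at most 9 (k + 1)^2 C1 B times the factor, hence 18; the final 1 stands
   for the local error B. *)
exists (C1 * (18 * k.+1%:R ^+ 2 * C1 + 1)).
  by rewrite mulr_ge0// addr_ge0// mulr_ge0// mulr_ge0// sqr_ge0.
move=> a b N alpha1 beta1 beta2 M u w h ab N0 M0 ab0 LG uS uM [wdg wmom wii wiii].
have h0 : 0 < h by exact: mesh_size_gt0.
have hn0 : h != 0 by rewrite gt_eqF.
have [uper cu _] := uS.
set B := M * h ^+ k.+2.
have B0 : 0 <= B by rewrite mulr_ge0// exprn_ge0// ltW.
have L0 := Lam_neq0 k.+1 h alpha1 beta1 beta2 isT h0 ab0.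
have [|q qP] := @choice nat {poly R} (fun j p => (j < N)%N ->
    (size p <= k.+2)%N /\ forall x, cell a b N j x -> w x = p.[x]).
  move=> j; have [jN|] := ltnP j N; last by exists 0.
  by have [p sp pE] := wdg j jN; exists p.
pose x_ := node a b N.
have xS j : x_ j.+1 = x_ j + h by exact: nodeS.
pose P j (t : R * R * R * R) := let: (y1, y2, z, z') := t in
  [/\ `|z| <= C1 * B /\ `|z'| <= C1 * (B / h),
      (q j).[x_ j.+1] = y1 + y2 + u (x_ j.+1)
      /\ (q j)^`().[x_ j.+1] =
         ((k * k.+1)%:R * y1 + (k.+1 * k.+2)%:R * y2) / h + derive1 u (x_ j.+1) + z',
      (q j).[x_ j] = (-1) ^+ k * (y1 - y2) + u (x_ j) + z
      /\ (q j)^`().[x_ j] =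
         (-1) ^+ k * (- (k * k.+1)%:R * y1 + (k.+1 * k.+2)%:R * y2) / h + derive1 u (x_ j)
    & forall t, cell a b N j t -> `|w t - u t| <= C1 * (`|y1| + `|y2| + B)].
have [|Y YP] := @choice nat _ (fun j t => (j < N)%N -> P j t).
  move=> j; have [jN|] := ltnP j N; last by exists (0, 0, 0, 0).
  have [sq wq] := qP j jN.
  have ax : a <= x_ j by exact: node_ge.
  have xb : x_ j + h <= b by rewrite -xS; exact: node_le.
  have [T [sT Tx T'x TB T'B]] :=
    sobolev_taylor_polynomial k.+1 u a b M isT ab M0 uS uM (x_ j) h ax h0 xb.
  have mom (v : {poly R}) : (size v <= k)%N ->
      \int[mu]_(t in `]x_ j, x_ j + h[) ((q j).[t] * v.[t]) =
      \int[mu]_(t in `]x_ j, x_ j + h[) (u t * v.[t]).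
    move=> sv; rewrite -xS -(wmom j jN v sv).
    by apply: eq_Rintegral => t; rewrite inE => /wq ->.
  have [y1 [y2 [z [z' [zB q1 q0 qu]]]]] :=
    decomp (x_ j) h B _ _ u T (q j) h0 cu sT Tx T'x TB T'B sq mom.
  exists (y1, y2, z, z'); rewrite /P xS; split => // t tc; rewrite wq//.
  apply: qu; move: tc; rewrite /cell /= in_itv/= -/x_ -/(x_ _) xS => /andP[? ?].
  by apply/andP; split; exact: ltW.
pose y1 j := (Y j).1.1.1; pose y2 j := (Y j).1.1.2.
pose z j := (Y j).1.2; pose z' j := (Y j).2.
have YE j : Y j = (y1 j, y2 j, z j, z' j).
  by rewrite /y1 /y2 /z /z'; case: (Y j) => [[[]]].
have {}YP j : (j < N)%N -> P j (y1 j, y2 j, z j, z' j) by rewrite -YE; exact: YP.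
pose s j := (j.+1 %% N)%N.
have sN j : (s j < N)%N by rewrite ltn_pmod.
(* Only the last interface needs an argument: there b is identified with a, and u and u' agree by
   periodicity. *)
have ux j : (j < N)%N -> u (x_ (s j)) = u (x_ j.+1) /\
    derive1 u (x_ (s j)) = derive1 u (x_ j.+1).
  move=> jN; have [jNE|jN1] := eqVneq j.+1 N; last first.
    by rewrite /s modn_small// ltn_neqAle jN1.
  rewrite /s jNE modnn /x_ nodeN// node0; split; last first.
    by rewrite -[b in RHS](subrKC a) derive1_periodic.
  by rewrite -[b in RHS](subrKC a) uper.
(* At the right end of cell j, the defect z of the left-end value belongs to the next cell, the
   defect z' of the right-end slope to cell j itself. The terms in u and u' cancel by consistency of
   the interface conditions. *)
have rec j : (j < N)%N -> cv2 (y1 j) (y2 j) =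
    transfer k.+1 h alpha1 beta1 beta2 *m cv2 (y1 (s j)) (y2 (s j))
    + (- z (s j) *: V1 k.+1 h alpha1 beta1 beta2 + - z' j *: V2 k.+1 h).
  move=> jN; rewrite !scaleNr -opprD.
  have [_ [qj1 q'j1] _ _] := YP j jN.
  have [_ _ [qs0 q's0] _] := YP (s j) (sN j).
  have [uxj u'xj] := ux j jN.
  have [_ wq] := qP j jN; have [_ wqs] := qP (s j) (sN j).
  have j1N : (0 < j.+1 <= N)%N by [].
  have := wii j.+1 j1N; have := wiii j.+1 j1N.
  rewrite /average /jump.
  rewrite (trace_minus_cell a b N ab N0 w (q j))//.
  rewrite (trace_plus_cell a b N ab N0 w (q (s j)))//.
  rewrite (trace_minus_cell a b N ab N0 (derive1 w) (q j)^`()); last exact: derive1_cell.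
  rewrite (trace_plus_cell a b N ab N0 (derive1 w) (q (s j))^`()); last exact: derive1_cell.
  rewrite -/(s j) -/x_ -/(x_ _) qj1 q'j1 qs0 q's0 uxj u'xj => E2 E1.
  have kE : k.+1%:R - 1 = k%:R :> R by rewrite -natr1 addrK.
  apply: (interface_solve k.+1 h alpha1 beta1 beta2) => //.
  - by move/eqP: E1; rewrite -subr_eq0 => /eqP <-; rewrite !natrM !exprS; field.
  - by move/eqP: E2; rewrite -subr_eq0 => /eqP <-; rewrite !natrM !exprS; field.
have zB j : (j < N)%N -> `|- z (s j)| <= C1 * B.
  by move=> jN; rewrite normrN; have [[]] := YP (s j) (sN j).
have z'B j : (j < N)%N -> `|- z' j| <= C1 * B / h.
  by move=> jN; rewrite normrN -mulrA; have [[]] := YP j jN.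
move=> j x jN xj.
have [yneg ypos] := factor_bound k.+1 N h alpha1 beta1 beta2 (C1 * B)
  (fun j => cv2 (y1 j) (y2 j)) _ _ isT h0 (mulr_ge0 C10 B0) L0 LG rec zB z'B j jN.
have [_ _ _ /(_ x xj) wu] := YP j jN.
have [f1 f2] := factor_ge1 k.+1 h alpha1 beta1 beta2 h0 L0 LG.
have fin (F : R) : 1 <= F -> `|cv2 (y1 j) (y2 j)| <= 9 * k.+1%:R ^+ 2 * (C1 * B) * F ->
    `|w x - u x| <= C1 * (18 * k.+1%:R ^+ 2 * C1 + 1) * B * F.
  move=> F1 yF; rewrite (le_trans wu)//.
  have := norm_entry_le (cv2 (y1 j) (y2 j)) 0; have := norm_entry_le (cv2 (y1 j) (y2 j)) 1.
  rewrite !cv2E => /le_trans/(_ yF) n1 /le_trans/(_ yF) n2.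
  rewrite -2!(mulrA C1) ler_wpM2l// -mulrA mulrDl mul1r.
  apply: lerD; last by rewrite ler_peMr.
  rewrite (le_trans (lerD n2 n1))// -subr_ge0 [leRHS](_ : _ = 0)//; ring.
by split=> G0; apply: fin; [exact: f1|exact: yneg|exact: f2|exact: ypos].
Qed.

End pointwise_error.

Theorem lemma3p4 (R : realType) (k : nat) (a b : R) :
  (1 <= k)%N -> a < b ->
  exists2 C : R, 0 < C &
  forall (N : nat) (alpha1 beta1 beta2 : R) (p : \bar R) (u w : R -> R),
    let h := mesh_size a b N in
    (0 < N)%N ->
    alpha1 ^+ 2 + beta1 * beta2 != 4^-1 ->
    `|Lam k h alpha1 beta1 beta2| < `|Gam k h alpha1 beta1 beta2| ->
    p = 2%:E \/ p = +oo%E ->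
    periodic_sobolev_oo k.+1 a b u ->
    is_Phstar a b N k alpha1 beta1 beta2 u w ->
    (Gam k h alpha1 beta1 beta2 < 0 ->
      (Lp_norm a b p (fun x => (w x - u x)%R)
       <= (C * h ^+ k.+1)%:E * sobolev_oo_seminorm k.+1 a b u
          * (factor_neg k h alpha1 beta1 beta2)%:E)%E) /\
    (0 < Gam k h alpha1 beta1 beta2 ->
      (Lp_norm a b p (fun x => (w x - u x)%R)
       <= (C * h ^+ k.+1)%:E * sobolev_oo_seminorm k.+1 a b u
          * (factor_pos k h alpha1 beta1 beta2)%:E)%E).
Proof.
move=> k1 ab; have [C C0 cellE] := @Phstar_cell_error R k k1.
have ba : 0 < 1 + (b - a) by rewrite addr_gt0// subr_gt0.
(* [C] may be 0; adding 1 makes the constant positive. *)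
exists ((1 + (b - a)) * C + 1); first by rewrite ltr_wpDl// mulr_ge0// ltW.
move=> N alpha1 beta1 beta2 p u w h N0 al LG pE uS Pw.
have h0 : 0 < h by exact: mesh_size_gt0.
have L0 := Lam_neq0 k h alpha1 beta1 beta2 k1 h0 al.
have [f1 f2] := factor_ge1 k h alpha1 beta1 beta2 h0 L0 LG.
have [_ cu _] := uS; have [wdg _ _ _] := Pw.
have mwu : measurable_fun (`[a, b] : set (measurableTypeR R)) (fun x => w x - u x).
  apply: measurable_funB; first exact: dg_space_measurable wdg.
  by apply: measurable_funTS; exact: continuous_measurable_fun.
set S := sobolev_oo_seminorm k.+1 a b u.
have S0 : (0 <= S)%E by exact: Lnorm_ge0.
have key (F : R) : 1 <= F ->
    (forall M : R, 0 <= M -> (S <= M%:E)%E -> forall j x, (j < N)%N -> cell a b N j x ->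
       `|w x - u x| <= C * (M * h ^+ k.+1) * F) ->
    (Lp_norm a b p (fun x => (w x - u x)%R)
     <= (((1 + (b - a)) * C + 1) * h ^+ k.+1)%:E * S * F%:E)%E.
  move=> F1 wuM.
  have F0 : 0 < F by rewrite (lt_le_trans ltr01).
  have hk : 0 < h ^+ k.+1 by rewrite exprn_gt0.
  have C'0 : 0 < ((1 + (b - a)) * C + 1) * h ^+ k.+1.
    by rewrite mulr_gt0// ltr_wpDl// mulr_ge0// ltW.
  (* If the seminorm is infinite, so is the right-hand side, because the constant and the factor are
     positive. *)
  move: S0 wuM; case: S => [M| |] // S0 wuM; last first.
    by rewrite gt0_muley ?lte_fin// gt0_mulye ?lte_fin// leey.
  rewrite lee_fin in S0.
  have E0 : 0 <= C * (M * h ^+ k.+1) * F.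
    by rewrite mulr_ge0 ?(ltW F0)// mulr_ge0// mulr_ge0// ltW.
  have ae := ae_cells a b N N0 _ (fun j x jN xj => wuM M S0 (lexx _) j x jN xj).
  rewrite (le_trans (Lp_norm_le a b _ _ p (ltW ab) pE E0 mwu ae))//.
  rewrite -!EFinM lee_fin.
  have : 0 <= h ^+ k.+1 * M * F by rewrite mulr_ge0 ?(ltW F0)// mulr_ge0// ltW.
  lra.
split=> G0; apply: key; [exact: f1| |exact: f2|] => M M0 SM j x jN xj.
- by have [+ _] := cellE a b N alpha1 beta1 beta2 M u w ab N0 M0 al LG uS SM Pw j x jN xj; exact.
- by have [_ +] := cellE a b N alpha1 beta1 beta2 M u w ab N0 M0 al LG uS SM Pw j x jN xj; exact.
Qed.
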